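(* There exist absolute constants $C,c_1,c_2,c_3>0$ such that if $n\log\big(n(p_1+p_2)\big)\le c_1p_1p_2$, then there is an event of probability at least $1-\exp(-c_2n)$ on which $$\|\hat h-h^*\|_2^2\le C\Big(\frac{\|\xi\|_2^2}{n}+\|h^*\|_{S_1}^2\,\frac{p_1+p_2}{n}\Big).$$ Moreover, if $s\max(p_1,p_2)\le c_3n$, then on the same event $$\|\hat h-h^*\|_2^2\le C\,\frac{\|\xi\|_2^2}{n}.$$
   Context: The space is $\mathbb R^{p_1\times p_2}$ with the trace (Frobenius) inner product $\langle\cdot,\cdot\rangle$ and its norm $\|\cdot\|_2$; $\|h\|_{S_1}$ is the nuclear norm (sum of singular values). Data: $Y_i=\langle X_i,h^*\rangle+\xi_i$, $i=1,\dots,n$, where $X_1,\dots,X_n\in\mathbb R^{p_1\times p_2}$ are independent random matrices with i.i.d. $\mathcal N(0,1)$ entries, $h^*\in\mathbb R^{p_1\times p_2}$ satisfies $\operatorname{rank}(h^* )\le s$, and $\xi=(\xi_1,\dots,\xi_n)$ is an arbitrary error vector (deterministic, random, or depending adversarially on the $X_i$ and $h^*$). The estimator $\hat h$ is a minimizer of $\|h\|_{S_1}$ over $h\in\mathbb R^{p_1\times p_2}$ subject to $\langle X_i,h\rangle=Y_i$, $i=1,\dots,n$. *)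

(* Defs.v *)
From HB Require Import structures.
From mathcomp Require Import all_boot all_order all_algebra.
From mathcomp Require Import complex.
From mathcomp Require Import all_classical all_reals all_analysis.

Set Implicit Arguments.
Unset Strict Implicit.
Unset Printing Implicit Defensive.

Import Order.TTheory GRing.Theory Num.Theory.
Import numFieldNormedType.Exports.

Local Open Scope classical_set_scope.
Local Open Scope ring_scope.

Definition mxdot (R : realType) (m n : nat) (A B : 'M[R]_(m, n)) : R :=
  \tr (A^T *m B).

(* For m = 1 this is the Euclidean norm of a row vector. *)
Definition frobenius_norm (R : realType) (m n : nat) (A : 'M[R]_(m, n)) : R :=
  Num.sqrt (mxdot A A).

(* The square roots of the n eigenvalues of A^T A, with multiplicity. They are
   read off the library's unitary diagonalization, which is over the complex
   numbers; those eigenvalues are real and nonnegative. At most min(m, n)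
   of the n values are nonzero, so the extra zeros do not affect sums. *)
Definition singular_value (R : realType) (m n : nat) (A : 'M[R]_(m, n))
    (j : 'I_n) : R :=
  Num.sqrt
    (complex.Re (spectral_diag (map_mx (real_complex R) (A^T *m A)) ord0 j)).

Definition nuclear_norm (R : realType) (m n : nat) (A : 'M[R]_(m, n)) : R :=
  \sum_(j < n) singular_value A j.

Definition borel_mx (R : realType) (m n : nat) :=
  g_sigma_algebraType (@open 'M[R]_(m, n)).

Definition mutually_independent (R : realType) (d : measure_display)
    (T : measurableType d) (P : probability T R) (I : finType)
    (d' : measure_display) (U : measurableType d') (X : I -> T -> U) : Prop :=
  forall (J : {set I}) (B : I -> set U),
    (forall i : I, i \in J -> measurable (B i)) ->
    P (\bigcap_(i in [set` J]) (X i @^-1` B i)) =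
    (\prod_(i in J) P (X i @^-1` B i))%E.

Definition standard_gaussian_mx (R : realType) (d : measure_display)
    (T : measurableType d) (P : probability T R) (m n : nat)
    (X : T -> 'M[R]_(m, n)) : Prop :=
  mutually_independent P
    (fun (jk : 'I_m * 'I_n) (w : T) => (X w jk.1 jk.2 : measurableTypeR R)) /\
  forall (j : 'I_m) (k : 'I_n) (B : set (measurableTypeR R)),
    measurable B -> P ((fun w => X w j k) @^-1` B) = normal_prob 0 1 B.

Definition interpolates (R : realType) (n p1 p2 : nat)
    (X : 'I_n -> 'M[R]_(p1, p2)) (Y : 'rV[R]_n) (h : 'M[R]_(p1, p2)) : Prop :=
  forall i : 'I_n, mxdot (X i) h = Y ord0 i.

Definition min_nuclear_norm_interpolant (R : realType) (n p1 p2 : nat)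
    (X : 'I_n -> 'M[R]_(p1, p2)) (Y : 'rV[R]_n) (h : 'M[R]_(p1, p2)) : Prop :=
  interpolates X Y h /\
  forall g : 'M[R]_(p1, p2),
    interpolates X Y g -> nuclear_norm h <= nuclear_norm g.

(* Main.v *)
Require Import Defs.
From HB Require Import structures.
From mathcomp Require Import all_boot all_order all_algebra.
From mathcomp Require Import complex.
From mathcomp Require Import ring lra.
From mathcomp Require Import all_classical all_reals all_analysis.
From mathcomp Require Import measurable_realfun.

(* Let A h = (<X_i, h>)_i, with adjoint A^*. Two facts hold with high
   probability.

   (1) |A^* la|_F^2 >= (p1 p2 / 12) |la|^2 for all la. Then the least-squares
   interpolant g = A^* (A A^* )^-1 xi of the noise has
   |g|_F^2 <= 12 |xi|^2 / (p1 p2); as |g|_{S_1} <= sqrt(min(p1, p2)) |g|_F, its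
   nuclear norm is at most a constant times |xi| / sqrt(max(p1, p2)).

   (2) (n / 6) |h|_F^2 <= |A h|^2 + K (p1 + p2) |h|_{S_1}^2 for all h.

   As h^* + g is feasible, |hhat|_{S_1} <= |h^*|_{S_1} + |g|_{S_1}. Applying (2)
   to hhat - h^*, which A maps to xi, gives the first bound; for low rank the
   decomposability of the nuclear norm replaces |h^*|_{S_1} by
   sqrt(s) |hhat - h^*|_F.

   Both facts come from one union bound. The unit ball of R^d lies in the hull
   of at most 64^d lattice points of norm at most 2, so the vectors h in
   question are, up to scaling, averages of a finite dictionary D (the products
   u v^T of lattice points for (2)). By a Gaussian small-ball estimate, the
   quadratic form q(h) = |A h|^2 - c |h|^2 is nonnegative on all r-fold sums of
   elements of D. Averaging q over r independent samples with mean h (Maurey)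
   gives (r - 1) q(h) + E q(D) >= 0, where E q(D) is at most the maximum of
   |A D|^2 over the dictionary. *)

Set Implicit Arguments.
Unset Strict Implicit.
Unset Printing Implicit Defensive.

Import Order.TTheory GRing.Theory Num.Theory.
Import numFieldNormedType.Exports.
Import HBNNSimple.

Local Open Scope classical_set_scope.
Local Open Scope ring_scope.

(** * Integration against densities and independent families *)

Section density.
Context (R : realType) (d d' : measure_display) (T : measurableType d)
  (U : measurableType d').
Local Open Scope ereal_scope.

(** The hypothesis says that [nu] is the image under [phi] of the measure with density [W]. Both
    sides agree on indicators of level sets, hence on simple functions, and monotone convergence
    passes to [f]. *)
Lemma ge0_integral_density (mu : {measure set T -> \bar R})
    (nu : {measure set U -> \bar R}) (phi : T -> U) (W : T -> R) (f : U -> R) :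
  measurable_fun setT phi -> measurable_fun setT W -> (forall t, 0 <= W t)%R ->
  (forall B, measurable B -> \int[mu]_(t in phi @^-1` B) (W t)%:E = nu B) ->
  measurable_fun setT f -> (forall u, 0 <= f u)%R ->
  \int[mu]_t (W t * f (phi t))%:E = \int[nu]_u (f u)%:E.
Proof.
move=> mphi mW W0 WE mf f0.
have mfE : measurable_fun setT (fun u => (f u)%:E) by exact/measurable_EFinP.
pose f_ := nnsfun_approx measurableT mfE.
have f_nd u : {homo (fun n => f_ n u) : a b / (a <= b)%N >-> (a <= b)%R}.
  by move=> a b ab; exact/lefP/nd_nnsfun_approx.
have f_cvg u : EFin \o (f_ ^~ u) @ \oo --> (f u)%:E.
  by apply: (@cvg_nnsfun_approx _ _ _ _ measurableT _ mfE) => // x _;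
    rewrite lee_fin.
have step n : \int[mu]_t (W t * f_ n (phi t))%:E = \int[nu]_u (f_ n u)%:E.
  have mpre r : measurable (f_ n @^-1` [set r]) by [].
  under [RHS]eq_integral do rewrite fimfunE -fsumEFin//.
  rewrite [RHS]ge0_integral_fsum//; last 2 first.
    - by move=> r; exact/measurable_EFinP/measurableT_comp.
    - by move=> r x _; rewrite EFinM nnfun_muleindic_ge0.
  under [LHS]eq_integral.
    move=> t _; rewrite fimfunE EFinM -fsumEFin// ge0_mule_fsumr; last first.
      by move=> r; rewrite EFinM nnfun_muleindic_ge0.
    over.
  rewrite [LHS]ge0_integral_fsum//; last 2 first.
  - move=> r; apply: emeasurable_funM; first exact/measurable_EFinP.
    apply/measurable_EFinP; apply: measurable_funM => //.
    by apply: (measurableT_comp _ mphi); exact: measurable_indic.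
  - by move=> r x _; apply: mule_ge0;
      rewrite ?lee_fin// -lee_fin EFinM nnfun_muleindic_ge0.
  apply: eq_fsbigr => r _.
  rewrite integralZl_indic_nnsfun// integral_indic// setIT.
  have [r0|r0] := ltP r 0%R.
    rewrite preimage_nnfun0// measure0 mule0 integral0_eq// => t _.
    by rewrite indic0 mulr0 mule0.
  rewrite -WE//.
  have mpp : measurable (phi @^-1` (f_ n @^-1` [set r])).
    by rewrite -[X in measurable X]setTI; exact: mphi.
  rewrite -ge0_integralZl//; last 2 first.
    - by apply/measurable_EFinP; apply: measurable_funS mW.
    - by move=> t _; rewrite lee_fin.
  rewrite [RHS]integral_mkcond; apply: eq_integral => t _.
  rewrite /patch indicE; case: ifPn => [/set_mem/= h|].
    by rewrite mem_set// mulr1 muleC.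
  by rewrite notin_setE => /= h; rewrite memNset// mulr0 mule0.
transitivity (limn (fun n => \int[mu]_t (W t * f_ n (phi t))%:E)).
  rewrite -monotone_convergence//=.
  - apply: eq_integral => t _; apply/esym/cvg_lim => //=.
    under eq_fun do rewrite EFinM.
    by rewrite EFinM; apply: cvgeZl => //; exact: f_cvg.
  - move=> n; apply/measurable_EFinP; apply: measurable_funM => //.
    exact: (measurableT_comp _ mphi).
  - by move=> n t _; rewrite lee_fin mulr_ge0.
  - by move=> t _ a b ab; rewrite lee_fin ler_wpM2l// f_nd.
under eq_fun do rewrite step.
rewrite -monotone_convergence//=.
- by apply: eq_integral => u _; apply/cvg_lim => //=; exact: f_cvg.
- by move=> n; exact/measurable_EFinP.
- by move=> n u _; rewrite lee_fin.
- by move=> u _ a b ab; rewrite lee_fin f_nd.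
Qed.

End density.

Section iid.
Context (R : realType) (d d' : measure_display) (T : measurableType d)
  (U : measurableType d') (P : probability T R) (nu : probability U R)
  (I : finType) (x : I -> T -> U).
Hypothesis mx : forall i, measurable_fun setT (x i).
Hypothesis xP : forall B : I -> set U,
  (forall i, measurable (B i)) ->
  P (\bigcap_i (x i @^-1` B i)) = (\prod_i nu (B i))%E.

Let measurable_preimage i (B : set U) :
  measurable B -> measurable (x i @^-1` B).
Proof. by move=> mB; rewrite -[X in measurable X]setTI; exact: mx. Qed.

(** Factors are released from being indicators one at a time. The induction runs over a list [s]
    outside which every factor is an indicator; when all are, the claim is [xP]. *)
Lemma integral_prod_iid (f : I -> U -> R) (m : I -> R) :
  (forall i, measurable_fun setT (f i)) -> (forall i u, 0 <= f i u) ->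
  (forall i, (\int[nu]_u (f i u)%:E = (m i)%:E)%E) ->
  (\int[P]_w (\prod_i f i (x i w))%:E = (\prod_i m i)%:E)%E.
Proof.
move=> mf f0 fm.
have [s sP] : exists s : seq I, forall i, i \notin s ->
    exists2 B : set U, measurable B & f i = \1_B.
  by exists (enum I) => i; rewrite mem_enum.
elim: s f m mf f0 fm sP => [|j s IH] f m mf f0 fm sP.
  have {}sP i : {B : set U | measurable B & f i = \1_B}.
    exact/cid2/sP.
  pose B i := s2val (sP i).
  have mB i : measurable (B i) by exact: (s2valP (sP i)).
  have fB i : f i = \1_(B i) by exact: (s2valP' (sP i)).
  have -> : (fun w => (\prod_i f i (x i w))%:E) =
      (fun w => (\1_(\bigcap_i (x i @^-1` B i)) w)%:E).
    apply/funext => w; congr EFin; rewrite indicE.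
    have [/set_mem h|/negP h] := boolP (w \in _).
      by rewrite big1// => i _; rewrite fB indicE mem_set//; exact: h.
    have [i hi] : exists i, ~ B i (x i w).
      by apply/existsNP => hB; apply: h; apply/mem_set => i _; exact: hB.
    by rewrite (bigD1 i)//= fB indicE memNset// mul0r.
  rewrite integral_indic//; last first.
    by apply: fin_bigcap_measurable => // i _; exact: measurable_preimage.
  rewrite setIT; apply: (etrans (xP mB)).
  rewrite -prodEFin; apply: eq_bigr => i _.
  by rewrite -fm fB integral_indic// setIT.
have [js|js] := boolP (j \in s).
  by apply: IH => // i si; apply: sP; rewrite inE negb_or si andbT;
    apply: contraNneq si => ->.
pose W w := \prod_(i | i != j) f i (x i w).
pose c := \prod_(i | i != j) m i.
have m0 i : 0 <= m i.
  by rewrite -lee_fin -fm; apply: integral_ge0 => u _; rewrite lee_fin.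
have c0 : 0 <= c by exact: prodr_ge0.
have W0 w : 0 <= W w by exact: prodr_ge0.
have mW : measurable_fun setT W.
  rewrite /W; under eq_fun do rewrite -big_filter.
  by apply: measurable_prod => i _; exact: (measurableT_comp (mf i)).
under eq_integral do rewrite (bigD1 j)//= mulrC.
(* The product [W] of the other factors serves as a density: its image under [x j] is [c] times
   [nu]. This is checked on a set [B] by replacing the factor [f j] by the indicator of [B], which
   the induction hypothesis covers. *)
rewrite (@ge0_integral_density _ _ _ _ _ P (mscale (NngNum c0) (nu))
   (x j) W (f j))//.
- rewrite ge0_integral_mscale//=; last by move=> u _; rewrite lee_fin.
    by rewrite [X in (_ * X)%E](fm j) -EFinM (bigD1 j)//= mulrC.
  exact/measurable_EFinP.
- move=> B mB.
  pose f' i := if i == j then \1_B else f i.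
  pose m' i := if i == j then fine (nu B) else m i.
  transitivity (\int[P]_w (\prod_i f' i (x i w))%:E)%E.
    rewrite integral_mkcond; apply: eq_integral => w _.
    rewrite (bigD1 j)//= [f' j]/f' eqxx indicE.
    rewrite (eq_bigr (fun i => f i (x i w))); last first.
      by move=> i ij; rewrite /f' (negPf ij).
    rewrite /patch; case: ifPn => [/set_mem/= h|].
      by rewrite mem_set// mul1r.
    by rewrite notin_setE => /= h; rewrite memNset// mul0r.
  rewrite (IH f' m'); last 4 first.
  - by move=> i; rewrite /f'; case: eqP => _ //; exact: measurable_indic.
  - by move=> i u; rewrite /f'; case: eqP.
  - move=> i; rewrite /f' /m'; case: eqP => _ //.
    by rewrite integral_indic// setIT fineK// fin_num_measure.
  - move=> i si; rewrite /f'; case: eqP => [_|/eqP ij]; first by exists B.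
    by apply: sP; rewrite inE negb_or ij.
  rewrite (bigD1 j)//= {1}/m' eqxx (eq_bigr m); last first.
    by move=> i ij; rewrite /m' (negPf ij).
  by rewrite EFinM fineK ?fin_num_measure// muleC.
Qed.

End iid.

(** * Moment generating functions of independent standard Gaussians *)

Section gauss.
Context (R : realType).

Lemma normal_expR (s : R) :
  (\int[normal_prob 0 1]_x (expR (s * x))%:E = (expR (s ^+ 2 / 2))%:E)%E.
Proof.
have me : measurable_fun [set: measurableTypeR R] (fun x : R => expR (s * x)).
  by apply: measurableT_comp => //; exact: measurable_funM.
rewrite -(@ge0_integral_density _ _ _ _ _ lebesgue_measure _ id
   (normal_pdf 0 1) (fun x => expR (s * x))) //; last 2 first.
- exact: measurable_normal_pdf.
- by move=> t; exact: normal_pdf_ge0.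
(* Completing the square turns the tilted standard density into a multiple of the normal density
   with mean [s]. *)
transitivity (\int[lebesgue_measure]_x
    ((expR (s ^+ 2 / 2))%:E * (normal_pdf s 1 x)%:E))%E.
  apply: eq_integral => x _.
  rewrite !normal_pdfE ?oner_neq0// -EFinM; congr EFin.
  rewrite /normal_fun /= mulrCA -mulrA -!expRD; congr (_ * expR _).
  by field.
rewrite ge0_integralZl//=.
- by rewrite integral_normal_pdf mule1.
- by apply/measurable_EFinP; exact: measurable_normal_pdf.
- by move=> x _; rewrite lee_fin normal_pdf_ge0.
Qed.

Context (d : measure_display) (T : measurableType d) (P : probability T R)
  (I : finType) (x : I -> T -> measurableTypeR R).
Hypothesis mx : forall i, measurable_fun setT (x i).
Hypothesis xP : forall B : I -> set (measurableTypeR R),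
  (forall i, measurable (B i)) ->
  P (\bigcap_i (x i @^-1` B i)) = (\prod_i normal_prob 0 1 (B i))%E.

Lemma joint_mgf (s : I -> R) :
  (\int[P]_w (expR (\sum_i s i * x i w))%:E =
    (expR ((\sum_i s i ^+ 2) / 2))%:E)%E.
Proof.
under eq_integral do rewrite expR_sum.
rewrite (@integral_prod_iid _ _ _ _ _ P (normal_prob 0 1) _ x mx xP (fun i u =>
  expR (s i * u))
  (fun i => expR (s i ^+ 2 / 2))).
- by rewrite -expR_sum mulr_suml.
- by move=> i; apply: measurableT_comp => //; exact: measurable_funM.
- by move=> i u; exact: expR_ge0.
- by move=> i; exact: normal_expR.
Qed.

End gauss.

(** * A hyperbolic inequality behind the small-ball estimate *)

Section cosh_bound.
Context (R : realType).
Implicit Types u v : R.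

(* [tanh (u / 2) <= u / 2] *)
Lemma expR_tanh_le u : 0 <= u -> 2 * (expR u - 1) <= u * (expR u + 1).
Proof.
move=> u0; rewrite -subr_ge0.
pose f := fun x : R => x * (expR x + 1) - 2 * (expR x - 1).
have df (x : R) : is_derive x (1 : R) f (1 + (x - 1) * expR x).
  by apply: is_derive_eq; rewrite /GRing.scale/=; ring.
have -> : 0 = f 0 :> R by rewrite /f expR0; ring.
apply: (@ger0_derive1_le_cc R f 0 u) => //.
- move=> x _; rewrite derive1E derive_val -[X in X <= _](subrr 1) lerD2l.
  rewrite -opprB mulNr lerN2 -(@ler_pM2r _ (expR (- x))) ?expR_gt0//.
  by rewrite -mulrA -expRD subrr expR0 mulr1 mul1r; have := expR_ge1Dx (- x).
- by apply: continuous_subspaceT => x;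
    apply/differentiable_continuous/derivable1_diffP.
- by rewrite in_itv/= lexx u0.
- by rewrite in_itv/= lexx u0.
Qed.

(* With [y = cosh v - 1], this is
   [y - y ^+ 2 / 2 <= 2 * tanh (v / 2) ^+ 2 <= v ^+ 2 / 2]. *)
Lemma cosh_sub_sq_le v :
  expR v + expR (- v) - (expR (2 * v) + expR (- (2 * v))) / 8 - 7 / 4 <=
  v ^+ 2 / 2.
Proof.
wlog v0 : v / 0 <= v => [h|].
  have [v0|/ltW v0] := leP 0 v; first exact: h.
  have := h (- v); rewrite oppr_ge0 => /(_ v0).
  by rewrite opprK mulrN opprK sqrrN; lra.
have := expR_tanh_le v0.
have e2 : expR (2 * v) = expR v ^+ 2 by rewrite mulr2n mulrDl mul1r expRD expr2.
have e1 : 1 <= expR v by have := expR_ge1Dx v; lra.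
rewrite !expRN e2; move: (expR v) e1 => e e1 h.
have -> : e + e^-1 - (e ^+ 2 + (e ^+ 2)^-1) / 8 - 7 / 4 =
  2 * ((e - 1) / (e + 1)) ^+ 2 -
    (e - 1) ^+ 2 * (e - 1) ^+ 4 / (8 * e ^+ 2 * (e + 1) ^+ 2).
  by field; rewrite !gt_eqF//; lra.
have : 2 * ((e - 1) / (e + 1)) ^+ 2 <= v ^+ 2 / 2.
  have : (e - 1) / (e + 1) <= v / 2 by rewrite ler_pdivrMr ?ltr_wpDl//; lra.
  have : 0 <= (e - 1) / (e + 1) by rewrite divr_ge0//; lra.
  nra.
suff : 0 <= (e - 1) ^+ 2 * (e - 1) ^+ 4 / (8 * e ^+ 2 * (e + 1) ^+ 2) by lra.
by rewrite !(mulr_ge0, exprn_ge0, invr_ge0)//; lra.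
Qed.

End cosh_bound.

(** * Small-ball and tail bounds for a Gaussian design *)

Section exponential_test.
Context (R : realType).

(* [1 - 2 / 3 * (y - y ^+ 2 / 2)] with [y = cosh v - 1], as a combination of
   exponentials of [v]: it dominates [expR (- v ^+ 2 / 2)], and products of such
   functions of linear forms have explicit expectations by the joint mgf. *)
Definition test_coef (k : 'I_5) : R :=
  nth 0 [:: 13 / 6; - (2 / 3); - (2 / 3); 1 / 12; 1 / 12] k.

Definition test_rate (k : 'I_5) : R := nth 0 [:: 0; 1; - 1; 2; - 2] k.

(** Put [q = y - y ^+ 2 / 2], so that [q <= v ^+ 2 / 2] and [q <= 1 / 2]. For [q > 0] the chain is
    [expR (- q) <= (1 + q)^-1 <= 1 - 2 / 3 * q], whose last step needs exactly [q <= 1 / 2]; for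
    [q <= 0] the right-hand side is at least one. *)
Lemma expRN_sq_le_test (v : R) :
  expR (- (v ^+ 2 / 2)) <= \sum_k test_coef k * expR (test_rate k * v).
Proof.
have := cosh_sub_sq_le v.
rewrite !big_ord_recl big_ord0 /test_coef /test_rate /=.
rewrite mul0r expR0 mulr1 mul1r addr0 !mulNr mul1r.
set q := _ - 7 / 4 => qv.
have q12 : q <= 1 / 2.
  have e2 : expR (2 * v) = expR v ^+ 2
    by rewrite mulr2n mulrDl mul1r expRD expr2.
  rewrite /q !expRN e2; have := expR_gt0 v; move: (expR v) => e e0.
  suff : 0 <= ((e + e^-1) / 2 - 2) ^+ 2.
    suff -> : ((e + e^-1) / 2 - 2) ^+ 2 = 2 *
       (1 / 2 - (e + e^-1 - (e ^+ 2 + (e ^+ 2)^-1) / 8 - 7 / 4)) by lra.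
    by field; rewrite gt_eqF.
  exact: sqr_ge0.
apply: (@le_trans _ _ (1 - 2 / 3 * q)); last by rewrite /q; lra.
have t0 : 0 <= v ^+ 2 / 2 by rewrite divr_ge0// sqr_ge0.
have [q0|q0] := leP q 0.
  apply: (@le_trans _ _ 1); last by lra.
  by rewrite -[leRHS]expR0 ler_expR oppr_le0.
apply: (@le_trans _ _ (expR (- q))); first by rewrite ler_expR lerN2.
rewrite expRN; apply: (@le_trans _ _ (1 + q)^-1).
  by rewrite lef_pV2 ?posrE ?expR_gt0 ?expR_ge1Dx//; lra.
rewrite -div1r ler_pdivrMr; last by lra.
nra.
Qed.

(** This is the Gaussian expectation of the test function at scale [Num.sqrt (2 * ln (5 / 4))]. That
    scale makes [expR (mu ^+ 2 / 2)] equal to 5/4, so the expectation is the rational number 1/2 +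
    (5/4)^4 / 6. *)
Lemma gauss_test_bounds :
  0 <= \sum_k test_coef k *
    expR ((test_rate k * Num.sqrt (2 * ln (5 / 4))) ^+ 2 / 2)
    <= 11 / 12.
Proof.
have l0 : 0 <= ln (5 / 4) :> R by apply: ln_ge0; lra.
rewrite !big_ord_recl big_ord0 /test_coef /test_rate /= !exprMn sqr_sqrtr;
  last first.
  by rewrite mulr_ge0.
rewrite expr0n /= !mul0r expR0 !sqrrN expr1n mul1r addr0 mulr1.
have -> : 2 * ln (5 / 4) / 2 = ln (5 / 4) :> R by field.
have -> : 2 ^+ 2 * (2 * ln (5 / 4)) / 2 = 4%:R * ln (5 / 4) :> R by field.
rewrite expRM_natl lnK ?posrE; last by lra.
by apply/andP; split; lra.
Qed.

End exponential_test.

Section markov.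
Context (R : realType) (d : measure_display) (T : measurableType d)
  (P : probability T R).

Lemma probability_le_integral (A : set T) (G : T -> R) :
  measurable A -> measurable_fun setT G -> (forall w, 0 <= G w) ->
  (forall w, A w -> 1 <= G w) -> (P A <= \int[P]_w (G w)%:E)%E.
Proof.
move=> mA mG G0 G1; rewrite -[A]setIT -integral_indic//.
apply: ge0_le_integral => //.
- exact/measurable_EFinP/measurable_indic.
- exact/measurable_EFinP.
- move=> w _; rewrite lee_fin indicE; case: (boolP (w \in A)) => //= /set_mem.
  exact: G1.
Qed.

Lemma measurable_set_le (f g : T -> R) : measurable_fun setT f ->
  measurable_fun setT g -> measurable [set w | f w <= g w].
Proof.
by move=> mf mg; rewrite -[X in measurable X]setTI; exact: measurable_fun_le.
Qed.

Lemma measurable_set_lt (f g : T -> R) : measurable_fun setT f ->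
  measurable_fun setT g -> measurable [set w | f w < g w].
Proof.
move=> mf mg; have -> : [set w | f w < g w] = ~` [set w | g w <= f w].
  by apply/seteqP; split => w /=; rewrite ltNge => /negP.
exact/measurableC/measurable_set_le.
Qed.

End markov.

Section gaussian_family.
Context (R : realType) (d : measure_display) (T : measurableType d)
  (P : probability T R) (I J : finType) (x : I -> J -> T -> R).
Hypothesis mx : forall i j, measurable_fun setT (x i j).
Hypothesis mgf : forall s : I -> J -> R,
  (\int[P]_w (expR (\sum_i \sum_j s i j * x i j w))%:E =
    (expR ((\sum_i \sum_j s i j ^+ 2) / 2))%:E)%E.

Definition design (z : J -> R) (w : T) (i : I) : R := \sum_j z j * x i j w.

Lemma measurable_design z i : measurable_fun setT (design z ^~ i).
Proof. by apply: measurable_sum => j; exact: measurable_funM. Qed.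

Lemma measurable_linear_form (s : I -> J -> R) :
  measurable_fun setT (fun w => \sum_i \sum_j s i j * x i j w).
Proof.
by apply: measurable_sum => i; apply: measurable_sum => j;
  exact: measurable_funM.
Qed.

Lemma measurable_design_sq z :
  measurable_fun setT (fun w => \sum_i design z w i ^+ 2).
Proof.
by apply: measurable_sum => i; apply: measurable_funX; exact: measurable_design.
Qed.

(** Chernoff's bound with exponential parameter one; the parameter is left to the scaling of [s]. *)
Lemma linear_form_tail (s : I -> J -> R) (t : R) :
  (P [set w | (t <= \sum_i \sum_j s i j * x i j w)%R] <=
   (expR ((\sum_i \sum_j s i j ^+ 2) / 2 - t))%:E)%E.
Proof.
have mL := measurable_linear_form s.
have mA : measurable [set w | t <= \sum_i \sum_j s i j * x i j w].
  exact: measurable_set_le.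
have : (P [set w | (t <= \sum_i \sum_j s i j * x i j w)%R] <=
    \int[P]_w (expR (- t) * expR (\sum_i \sum_j s i j * x i j w))%:E)%E.
  apply: probability_le_integral => //.
  - by apply: measurable_funM => //; exact: measurableT_comp.
  - by move=> w /= tL; rewrite -expRD -[leLHS]expR0 ler_expR; lra.
move=> /le_trans; apply; under eq_integral do rewrite EFinM;
  rewrite ge0_integralZl//=.
- by rewrite mgf -EFinM -expRD addrC.
- by apply/measurable_EFinP; exact: measurableT_comp.
Qed.

(** Expanding the product over all choice functions from [I] to ['I_5] leaves exponentials of linear
    forms. Each is integrated by [mgf], and the result factors again. *)
Lemma integral_prod_test (c a : 'I_5 -> R) (z : J -> R) :
  \sum_j z j ^+ 2 = 1 ->
  (\int[P]_w (\prod_i \sum_k c k * expR (a k * design z w i))%:E =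
   ((\sum_k c k * expR (a k ^+ 2 / 2)) ^+ #|I|)%:E)%E.
Proof.
move=> z1.
have E (f : {ffun I -> 'I_5}) w :
    \prod_i (c (f i) * expR (a (f i) * design z w i)) =
    (\prod_i c (f i)) * expR (\sum_i \sum_j (a (f i) * z j) * x i j w).
  rewrite big_split/= -expR_sum; congr (_ * expR _); apply: eq_bigr => i _.
  by rewrite mulr_sumr; apply: eq_bigr => j _; rewrite mulrA.
have mE (f : {ffun I -> 'I_5}) : measurable_fun setT (fun w =>
   expR (\sum_i \sum_j (a (f i) * z j) * x i j w)).
  by apply: measurableT_comp => //; exact: measurable_linear_form.
have iE (f : {ffun I -> 'I_5}) : P.-integrable setT (fun w =>
   (expR (\sum_i \sum_j (a (f i) * z j) * x i j w))%:E).
  apply/integrableP; split; first exact/measurable_EFinP.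
  under eq_integral do rewrite gee0_abs ?lee_fin ?expR_ge0//.
  by rewrite mgf ltry.
transitivity (\int[P]_w (\sum_(f : {ffun I -> 'I_5})
   ((\prod_i c (f i))%:E *
     (expR (\sum_i \sum_j (a (f i) * z j) * x i j w))%:E)))%E.
  apply: eq_integral => w _; rewrite bigA_distr_bigA/= -sumEFin.
  by apply: eq_bigr => f _; rewrite E EFinM.
rewrite integral_sum//; last by move=> f; apply: integrableZl => //; exact: iE.
transitivity (\sum_(f : {ffun I -> 'I_5})
   (\prod_i (c (f i) * expR (a (f i) ^+ 2 / 2)))%:E)%E.
  apply: eq_bigr => f _; rewrite integralZl// mgf -EFinM; congr EFin.
  rewrite big_split/= -expR_sum; congr (_ * expR _).
  rewrite mulr_suml; apply: eq_bigr => i _; congr (_ / _).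
  under eq_bigr do rewrite exprMn.
  by rewrite -mulr_sumr z1 mulr1.
by rewrite sumEFin -(bigA_distr_bigA (fun _ k => c k * expR (a k ^+ 2 / 2)))
  prodr_const.
Qed.

(** Markov's inequality for [expR (N / 24)] times the product of test functions. On the event,
    [ln (5 / 4) <= 1 / 4] gives [ln (5 / 4) * S <= N / 24], so this variable is at least one; its
    mean is at most [expR (N / 24) * (11 / 12) ^+ #|I|], and [11 / 12 <= expR (- (1 / 12))]. *)
Lemma small_ball1 (z : J -> R) : \sum_j z j ^+ 2 = 1 ->
  (P [set w | (\sum_i design z w i ^+ 2 < #|I|%:R / 6)%R] <=
   (expR (- (#|I|%:R / 24)))%:E)%E.
Proof.
move=> z1; set A := [set w | _].
have mA : measurable A.
  by apply: measurable_set_lt => //; exact: measurable_design_sq.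
pose mu : R := Num.sqrt (2 * ln (5 / 4)).
have l0 : 0 <= ln (5 / 4) :> R by apply: ln_ge0; lra.
have l1 : ln (5 / 4) <= 1 / 4 :> R.
  have -> : 5 / 4 = 1 + 1 / 4 :> R by field.
  by apply: le_ln1Dx; lra.
have mu2 : mu ^+ 2 = 2 * ln (5 / 4) by rewrite sqr_sqrtr// mulr_ge0.
pose phi (u : R) := \sum_k test_coef R k * expR (test_rate R k * mu * u).
have phi_ge u : expR (- (mu ^+ 2 * u ^+ 2 / 2)) <= phi u.
  rewrite -exprMn (le_trans (expRN_sq_le_test _))// /phi.
  by under [leRHS]eq_bigr do rewrite -mulrA.
have phi0 u : 0 <= phi u by rewrite (le_trans _ (phi_ge u)) ?expR_ge0.
have mphi : measurable_fun setT (fun w => \prod_i phi (design z w i)).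
  apply: measurable_prod => i _; apply: measurable_sum => k.
  apply: measurable_funM => //; apply: measurableT_comp => //.
  by apply: measurable_funM => //; exact: measurable_design.
set N : R := #|I|%:R.
have : (P A <= \int[P]_w (expR (N / 24) * \prod_i phi (design z w i))%:E)%E.
  apply: probability_le_integral => //.
  - exact: measurable_funM.
  - by move=> w /=; rewrite mulr_ge0 ?expR_ge0// prodr_ge0.
  - move=> w; rewrite /A /= => wA.
    apply: (@le_trans _ _ (expR (N / 24) *
      \prod_i expR (- (mu ^+ 2 * design z w i ^+ 2 / 2)))).
      rewrite -expR_sum -expRD -[leLHS]expR0 ler_expR sumrN -mulr_suml
        -mulr_sumr mu2.
      rewrite subr_ge0 mulrAC -mulrA; move: wA; rewrite -/N.
      set S := \sum_i _ => wA.
      have S0 : 0 <= S by apply: sumr_ge0 => i _; exact: sqr_ge0.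
      nra.
    rewrite ler_wpM2l ?expR_ge0//; apply: ler_prod => i _.
    by rewrite expR_ge0 phi_ge.
move=> /le_trans; apply; under eq_integral do rewrite EFinM;
  rewrite ge0_integralZl//=; last 2 first.
- exact/measurable_EFinP.
- by move=> w _; rewrite lee_fin prodr_ge0.
rewrite (integral_prod_test _ (fun k => test_rate R k * mu) z1) -EFinM lee_fin.
have e1112 : 11 / 12 <= expR (- (1 / 12)) :> R by have :=
  expR_ge1Dx (- (1 / 12) : R); lra.
apply: (@le_trans _ _ (expR (N / 24) * expR (- (1 / 12)) ^+ #|I|)).
  rewrite ler_wpM2l ?expR_ge0// lerXn2r ?nnegrE ?expR_ge0//.
    by case/andP: (gauss_test_bounds R).
  by case/andP: (gauss_test_bounds R) => _ h; exact: le_trans h e1112.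
rewrite -expRM_natl -expRD ler_expR -/N mulrC -mulr_natr -/N.
lra.
Qed.

End gaussian_family.

(** * A lattice whose hull contains the unit ball *)

Section lattice.
Context (R : realType) (J : finType).

(** Integer points of squared norm at most [4 * #|J|], coded by magnitude and sign; [lattice_vec]
    rescales them to norm at most 2. The magnitude range loses nothing, as a natural number is at
    most its square. Zero carries two signs, which only enlarges the count. *)
Definition lattice : Type := {k : {ffun J -> 'I_(4 * #|J|).+1 * bool} |
  (\sum_j (k j).1 ^ 2 <= 4 * #|J|)%N}.
HB.instance Definition _ := Finite.on lattice.

Definition lattice_vec (k : lattice) (j : J) : R :=
  (-1) ^+ (val k j).2 * (val k j).1%:R / Num.sqrt #|J|%:R.

Lemma lattice_vec_norm (k : lattice) : \sum_j lattice_vec k j ^+ 2 <= 4.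
Proof.
have [J0|J0] := posnP #|J|.
  by rewrite big1// => j; move: (fintype0 j J0).
under eq_bigr do rewrite !exprMn sqrr_sign mul1r exprVn sqr_sqrtr// -natrX.
rewrite -mulr_suml -natr_sum ler_pdivrMr ?ltr0n// -natrM ler_nat.
exact: (valP k).
Qed.

Lemma geometric_half_le n : \sum_(i < n) (2^-1 : R) ^+ i <= 2.
Proof.
have -> : \sum_(i < n) (2^-1 : R) ^+ i = 2 - 2 * 2^-1 ^+ n.
  elim: n => [|n IH]; first by rewrite big_ord0 expr0; ring.
  by rewrite big_ord_recr/= IH exprS; field.
by rewrite lerBlDr lerDl mulr_ge0// exprn_ge0// invr_ge0.
Qed.

(** Weighted counting. Give a coordinate of magnitude m the weight 16 / 2^m: a lattice point has
    total weight at least one because the magnitudes sum to at most [4 * #|J|]. Over all points the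
    weights factor, each coordinate contributing at most 2 * 16 * 2 = 64. *)
Lemma card_lattice : (#|{: lattice}| <= 64 ^ #|J|)%N.
Proof.
rewrite -(ler_nat R) card_sig -sum1_card natr_sum.
pose g (c : 'I_(4 * #|J|).+1 * bool) : R := 16 * 2^-1 ^+ c.1.
have g0 c : 0 <= g c by rewrite mulr_ge0// exprn_ge0// invr_ge0.
apply: (@le_trans _ _ (\sum_(k : {ffun J -> 'I_(4 * #|J|).+1 * bool})
    \prod_j g (k j))).
  rewrite big_mkcond/=; apply: ler_sum => k _; case: ifPn => [|_];
    last exact: prodr_ge0.
  rewrite inE => /= hk;
    rewrite /g big_split/= prodr_const prodrXr exprVn ler_pdivlMr ?exprn_gt0//.
  have -> : 16 = 2 ^+ 4 :> R by rewrite -natrX.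
  rewrite mul1r -exprM ler_eXn2l ?ltr1n//; apply: leq_trans hk.
  by apply: leq_sum => j _; case: (k j).1 => [[|m] _]//=; rewrite leq_pmulr.
rewrite -(bigA_distr_bigA (fun _ c => g c)) prodr_const natrX.
apply: lerXn2r; rewrite ?nnegrE ?sumr_ge0//.
rewrite -(pair_bigA _ (fun i b => g (i, b)))/=.
under eq_bigr do rewrite big_bool /g/=.
rewrite big_split/= -!mulr_sumr.
have := geometric_half_le (4 * #|J|).+1; lra.
Qed.

(** The marginal of a product distribution: the weights of the other coordinates sum to one. *)
Lemma sum_prod_weights (w : J -> bool -> R) (g : bool -> R) (j : J) :
  (forall i, \sum_c w i c = 1) ->
  \sum_(b : {ffun J -> bool}) (\prod_i w i (b i)) * g (b j) =
  \sum_c w j c * g c.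
Proof.
move=> w1; pose w' i c := w i c * (if i == j then g c else 1).
transitivity (\sum_(b : {ffun J -> bool}) \prod_i w' i (b i)).
  apply: eq_bigr => b _; rewrite big_split/=; congr (_ * _).
  by rewrite (bigD1 j)//= eqxx big1 ?mulr1// => i /negPf ->.
rewrite -(bigA_distr_bigA w') (bigD1 j)//= [X in _ * X]big1 ?mulr1.
  by apply: eq_bigr => c _; rewrite /w' eqxx.
by move=> i /negPf ij; rewrite -(w1 i); apply: eq_bigr => c _;
  rewrite /w' ij mulr1.
Qed.

(* Independent unbiased rounding of the coordinates to the lattice. *)
Lemma lattice_hull (y : J -> R) : \sum_j y j ^+ 2 <= 1 ->
  exists (al : {ffun J -> bool} -> R) (f : {ffun J -> bool} -> lattice),
    [/\ forall b, 0 <= al b, \sum_b al b = 1 &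
        forall j, \sum_b al b * lattice_vec (f b) j = y j].
Proof.
move=> y1.
pose D : R := Num.sqrt #|J|%:R.
have D2 : D ^+ 2 = #|J|%:R by rewrite sqr_sqrtr.
have Dy j : 0 <= D * `|y j| by rewrite mulr_ge0 ?sqrtr_ge0.
pose m j := Num.truncn (D * `|y j|).
pose th j := D * `|y j| - (m j)%:R.
have mle j : (m j)%:R <= D * `|y j| by rewrite truncn_le.
have th0 j : 0 <= th j by rewrite subr_ge0.
have th1 j : th j <= 1.
  have := truncnS_gt (D * `|y j|); rewrite -/(m j) -natr1 /th; lra.
(* The rounded point stays in the lattice since (m + b)^2 <= 2 m^2 + 2, and the two parts sum to at
   most [2 * #|J|] each. *)
have mb (b : {ffun J -> bool}) : (\sum_j (m j + b j) ^ 2 <= 4 * #|J|)%N.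
  rewrite -(ler_nat R) natr_sum.
  apply: (@le_trans _ _ (\sum_j (2 * D ^+ 2 * y j ^+ 2 + 2))).
    apply: ler_sum => j _; rewrite natrX natrD.
    rewrite -[y j ^+ 2]real_normK ?num_real// -mulrA -exprMn.
    have : (m j)%:R ^+ 2 <= (D * `|y j|) ^+ 2 :> R by rewrite lerXn2r ?nnegrE.
    have := sqr_ge0 ((m j)%:R - 1 : R); case: (b j) => /=; nra.
  rewrite big_split/= -mulr_sumr sumr_const D2 natrM -mulr_natr.
  have : 0 <= #|J|%:R :> R by [].
  nra.
have mb4 (b : {ffun J -> bool}) j : (m j + b j < (4 * #|J|).+1)%N.
  rewrite ltnS (leq_trans _ (mb b))// (bigD1 j)//=
    (leq_trans _ (leq_addr _ _))//.
  by case: (m j + b j)%N => // k; rewrite leq_pmulr.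
pose k (b : {ffun J -> bool}) : {ffun J -> 'I_(4 * #|J|).+1 * bool} :=
  [ffun j => (Ordinal (mb4 b j), y j < 0)].
have kP b : (\sum_j (k b j).1 ^ 2 <= 4 * #|J|)%N.
  by under eq_bigr do rewrite ffunE /=; exact: mb.
(* Rounding up with probability the fractional part [th j] makes the rounding unbiased. *)
pose w j (c : bool) := if c then th j else 1 - th j.
have w1 j : \sum_c w j c = 1 by rewrite big_bool/= addrC subrK.
exists (fun b => \prod_j w j (b j)), (fun b => exist _ (k b) (kP b)); split.
- by move=> b; apply: prodr_ge0 => j _; rewrite /w; case: (b j);
    rewrite ?subr_ge0.
- by rewrite -(bigA_distr_bigA w) big1.
- move=> j; rewrite /lattice_vec /=.
  under eq_bigr do rewrite ffunE /=.
  rewrite (@sum_prod_weights w (fun c =>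
    (-1) ^+ (y j < 0)%R * (m j + c)%:R / D))//.
  rewrite big_bool /= addn1 addn0 -natr1.
  have D0 : D != 0.
    by rewrite gt_eqF// sqrtr_gt0 ltr0n; apply/card_gt0P; exists j.
  rewrite /w /th [RHS]numEsign; set s := (-1) ^+ _.
  by field.
Qed.

End lattice.

(** * Lower bounds over the hull of a finite dictionary *)

Section maurey.
Context (R : realFieldType).

(* Empirical-method argument of Maurey: averaging over one more random
   element of the dictionary replaces it by its mean [h], at the cost [e]. *)
Lemma maurey_average (V : zmodType) (q : V -> R) (L : finType) (al : L -> R)
    (D : L -> V) (h : V) (e : R) :
  (forall l, 0 <= al l) -> \sum_l al l = 1 ->
  (forall v, \sum_l al l * q (v + D l) = q (v + h) + e) ->
  forall r v, (forall t : r.-tuple L, 0 <= q (v + \sum_(l <- t) D l)) ->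
  0 <= q (v + h *+ r) + e *+ r.
Proof.
move=> al0 al1 hq; elim=> [|r IH] v hv.
  by have := hv [tuple]; rewrite big_nil !mulr0n !addr0.
rewrite mulrSr [e *+ _]mulrSr [v + _]addrA.
have : 0 <= \sum_l al l * (q (v + h *+ r + D l) + e *+ r).
  apply: sumr_ge0 => l _; rewrite mulr_ge0// addrAC; apply: IH => t.
  by have := hv [tuple of l :: t]; rewrite big_cons addrA.
under eq_bigr do rewrite mulrDr.
rewrite big_split/= -mulr_suml al1 mul1r hq.
by rewrite [e *+ r + e]addrC addrA.
Qed.

End maurey.

Section union_bound.
Context (R : realType) (d : measure_display) (T : measurableType d)
  (P : probability T R).

Lemma probability_bigcap_ge (F : finType) (A : F -> set T) (eps : R) :
  (forall f, measurable (A f)) -> (forall f, (P (~` A f) <= eps%:E)%E) ->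
  ((1 - #|F|%:R * eps)%:E <= P (\bigcap_f A f))%E.
Proof.
move=> mA hA.
have mC f : measurable (~` A f) by exact: measurableC.
have mI : measurable (\bigcap_f A f) by exact: fin_bigcap_measurable.
have h : (P (~` \bigcap_f A f) <= (#|F|%:R * eps)%:E)%E.
  apply: (le_trans (@content_sub_fsum _ _ _ P F setT _ (fun f =>
    ~` A f) _ _ _ _)) => //.
  - exact: finite_finset.
  - exact: measurableC.
  - by rewrite setC_bigcap.
  have -> : [set: F] = [set` enum F].
    by apply/seteqP; split => f //= _; rewrite mem_enum.
  rewrite -fsbig_seq ?enum_uniq// big_enum/=;
    apply: (@le_trans _ _ (\sum_(f : F) eps%:E)%E).
    exact: lee_sum.
  by rewrite sumEFin sumr_const mulr_natl.
move: h; rewrite probability_setC// -[P _]fineK ?fin_num_measure//.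
by rewrite -EFinB !lee_fin; lra.
Qed.

Lemma probability_setI_ge (A B : set T) (a b : R) :
  measurable A -> measurable B ->
  ((1 - a)%:E <= P A)%E -> ((1 - b)%:E <= P B)%E ->
  ((1 - (a + b))%:E <= P (A `&` B))%E.
Proof.
move=> mA mB hA hB; have mAB : measurable (A `&` B) by exact: measurableI.
have : (P (~` (A `&` B)) <= P (~` A) + P (~` B))%E.
  by rewrite setCI; apply: measureU2; exact: measurableC.
move: hA hB; rewrite !probability_setC//.
rewrite -[P A]fineK ?fin_num_measure// -[P B]fineK ?fin_num_measure//.
rewrite -[P (A `&` B)]fineK ?fin_num_measure//.
by rewrite -!EFinB -EFinD !lee_fin; lra.
Qed.

End union_bound.

Section restricted_lower_bound.
Context (R : realType) (d : measure_display) (T : measurableType d)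
  (P : probability T R) (I J : finType) (x : I -> J -> T -> R).
Hypothesis mx : forall i j, measurable_fun setT (x i j).
Hypothesis mgf : forall s : I -> J -> R,
  (\int[P]_w (expR (\sum_i \sum_j s i j * x i j w))%:E =
    (expR ((\sum_i \sum_j s i j ^+ 2) / 2))%:E)%E.

Local Notation A := (design x).

Lemma designZ (c : R) (z : J -> R) w i : A (fun j => c * z j) w i = c * A z w i.
Proof. by rewrite /design mulr_sumr; apply: eq_bigr => j _; rewrite mulrA. Qed.

Lemma designD (y z : J -> R) w i :
  A (fun j => y j + z j) w i = A y w i + A z w i.
Proof. by rewrite /design -big_split; apply: eq_bigr => j _;
  rewrite mulrDl. Qed.

Lemma design_sum (L : finType) (al : L -> R) (D : L -> J -> R) w i :
  A (fun j => \sum_l al l * D l j) w i = \sum_l al l * A (D l) w i.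
Proof.
rewrite /design; under eq_bigr do rewrite mulr_suml.
rewrite exchange_big/=; apply: eq_bigr => l _.
by rewrite mulr_sumr; apply: eq_bigr => j _; rewrite mulrA.
Qed.

Lemma small_ball (z : J -> R) :
  (P [set w | (\sum_i A z w i ^+ 2 < #|I|%:R / 6 * \sum_j z j ^+ 2)%R] <=
   (expR (- (#|I|%:R / 24)))%:E)%E.
Proof.
have [z0|z0] := eqVneq (\sum_j z j ^+ 2) 0.
  rewrite (_ : [set w | _] = set0); last first.
    apply/seteqP; split => w //=; rewrite z0 mulr0 ltNge => /negP; apply.
    by apply: sumr_ge0 => i _; exact: sqr_ge0.
  by rewrite measure0 lee_fin expR_ge0.
have {}z0 : 0 < \sum_j z j ^+ 2.
  by rewrite lt_neqAle eq_sym z0 sumr_ge0// => j _; exact: sqr_ge0.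
set S := \sum_j z j ^+ 2 in z0 *.
have S0 : 0 < Num.sqrt S by rewrite sqrtr_gt0.
have := @small_ball1 _ _ _ P _ _ _ mx mgf (fun j => (Num.sqrt S)^-1 * z j).
have AE w : \sum_i A (fun j => (Num.sqrt S)^-1 * z j) w i ^+ 2 =
  S^-1 * \sum_i A z w i ^+ 2.
  rewrite mulr_sumr; apply: eq_bigr => i _.
  by rewrite designZ exprMn exprVn sqr_sqrtr ?ltW.
under eq_set do rewrite AE mulrC ltr_pdivrMr//.
apply; under eq_bigr do rewrite exprMn.
by rewrite -mulr_sumr exprVn sqr_sqrtr ?ltW// mulVf// gt_eqF.
Qed.

(** With the form scaled by [Num.sqrt N], the sum of squared coefficients is at most 4 * 16 * N.
    Chernoff at threshold [40 * N] gives the exponent 32 N - 40 N = - 8 N, enough to beat the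
    [64 ^ #|I|] lattice points. *)
Lemma bilinear_tail (la : I -> R) (z : J -> R) :
  \sum_i la i ^+ 2 <= 4 -> \sum_j z j ^+ 2 <= 16 ->
  (P [set w | (40 * Num.sqrt #|I|%:R < \sum_i la i * A z w i)%R] <=
   (expR (- (8 * #|I|%:R)))%:E)%E.
Proof.
move=> la4 z16; set N : R := #|I|%:R.
have N0 : 0 <= N by [].
pose s i j := Num.sqrt N * (la i * z j).
have sE w : \sum_i \sum_j s i j * x i j w = Num.sqrt N * \sum_i la i * A z w i.
  rewrite mulr_sumr; apply: eq_bigr => i _.
  by rewrite /design !mulr_sumr; apply: eq_bigr => j _; rewrite /s !mulrA.
have s2 : \sum_i \sum_j s i j ^+ 2 <= 64 * N.
  rewrite (_ : \sum_i _ = N * ((\sum_i la i ^+ 2) * \sum_j z j ^+ 2));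
    last first.
    rewrite mulr_suml mulr_sumr; apply: eq_bigr => i _.
    by rewrite !mulr_sumr; apply: eq_bigr => j _; rewrite /s !exprMn sqr_sqrtr.
  rewrite mulrC ler_wpM2r//.
  have : 0 <= \sum_i la i ^+ 2 by apply: sumr_ge0 => i _; exact: sqr_ge0.
  have : 0 <= \sum_j z j ^+ 2 by apply: sumr_ge0 => i _; exact: sqr_ge0.
  nra.
have := @linear_form_tail _ _ _ P _ _ _ mx mgf s (40 * N) => tail.
apply: (@le_trans _ _
  (P [set w | (40 * N <= \sum_i \sum_j s i j * x i j w)%R])).
  apply: le_measure; rewrite ?inE.
  - apply: measurable_set_lt => //; apply: measurable_sum => i.
    by apply: measurable_funM => //; exact: measurable_design.
  - by apply: measurable_set_le => //; exact: measurable_linear_form.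
  - move=> w /= h; rewrite sE -{1}[N]sqr_sqrtr// expr2 mulrCA.
    by rewrite ler_wpM2l ?sqrtr_ge0// ltW.
apply: (le_trans tail); rewrite lee_fin ler_expR; lra.
Qed.

(* A sphere vector lies in the hull of the lattice, so the norm of [y] is an
   average of the pairings of [y] with lattice vectors. *)
Lemma norm_le_lattice (y : I -> R) (t : R) : 0 <= t ->
  (forall la : lattice I, \sum_i lattice_vec R la i * y i <= t) ->
  \sum_i y i ^+ 2 <= t ^+ 2.
Proof.
move=> t0 hy; set S := \sum_i y i ^+ 2.
have S0 : 0 <= S by apply: sumr_ge0 => i _; exact: sqr_ge0.
have [->|Sn0] := eqVneq S 0; first exact: sqr_ge0.
have sS0 : Num.sqrt S != 0 by rewrite sqrtr_eq0 -ltNge lt_neqAle eq_sym Sn0.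
have [|al [f [al0 al1 fE]]] := @lattice_hull R I (fun i => y i / Num.sqrt S).
  under eq_bigr do rewrite exprMn.
  by rewrite -mulr_suml exprVn sqr_sqrtr// divff.
rewrite -[S]sqr_sqrtr// lerXn2r ?nnegrE ?sqrtr_ge0//.
have -> : Num.sqrt S = \sum_b al b * \sum_i lattice_vec R (f b) i * y i.
  transitivity (\sum_i y i / Num.sqrt S * y i).
    under eq_bigr do rewrite mulrAC -expr2.
    by rewrite -mulr_suml -/S -{2}[S]sqr_sqrtr// expr2 mulfK.
  under [RHS]eq_bigr do rewrite mulr_sumr.
  rewrite exchange_big; apply: eq_bigr => i _.
  by rewrite -fE mulr_suml; apply: eq_bigr => b _; rewrite mulrA.
rewrite -[leRHS]mul1r -al1 mulr_suml; apply: ler_sum => b _.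
by rewrite ler_wpM2l.
Qed.

(** [E1] makes the quadratic form [q] nonnegative on every [r]-fold sum from the dictionary. [E2]
    bounds the image of each dictionary element by [40 * Num.sqrt N] in norm, tested against lattice
    directions; this gives 1600 = 40^2. Maurey's argument then runs deterministically on their
    intersection. *)
Lemma restricted_lower_bound (K : finType) (D : K -> J -> R) (r : nat) :
  (0 < r)%N -> (forall k, \sum_j D k j ^+ 2 <= 16) ->
  exists2 E : set T, measurable E &
    ((1 - ((#|K| ^ r)%:R * expR (- (#|I|%:R / 24)) +
           (#|K| * 64 ^ #|I|)%:R * expR (- (8 * #|I|%:R))))%:E <= P E)%E /\
  forall w, E w -> forall (L : finType) (al : L -> R) (f : L -> K) (h : J -> R),
    (forall l, 0 <= al l) -> \sum_l al l = 1 ->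
    (forall j, h j = \sum_l al l * D (f l) j) ->
    (r%:R - 1) * (#|I|%:R / 6 * \sum_j h j ^+ 2) <=
      (r%:R - 1) * (\sum_i A h w i ^+ 2) + 1600 * #|I|%:R.
Proof.
move=> r0 D16; set N : R := #|I|%:R.
have N0 : 0 <= N by [].
pose Dt (t : r.-tuple K) j := \sum_(k <- t) D k j.
pose E1 := \bigcap_(t : r.-tuple K)
  ~` [set w | \sum_i A (Dt t) w i ^+ 2 < N / 6 * \sum_j Dt t j ^+ 2].
pose E2 := \bigcap_(kl : K * lattice I)
  ~` [set w | 40 * Num.sqrt N < \sum_i lattice_vec R kl.2 i * A (D kl.1) w i].
have mA1 (t : r.-tuple K) : measurable
   [set w | \sum_i A (Dt t) w i ^+ 2 < N / 6 * \sum_j Dt t j ^+ 2].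
  by apply: measurable_set_lt => //; exact: measurable_design_sq.
have mA2 (kl : K * lattice I) : measurable
   [set w | 40 * Num.sqrt N < \sum_i lattice_vec R kl.2 i * A (D kl.1) w i].
  apply: measurable_set_lt => //; apply: measurable_sum => i.
  by apply: measurable_funM => //; exact: measurable_design.
have mE1 : measurable E1 by apply: fin_bigcap_measurable => // t _;
  exact: measurableC.
have mE2 : measurable E2 by apply: fin_bigcap_measurable => // t _;
  exact: measurableC.
exists (E1 `&` E2); first exact: measurableI.
split.
  have h1 : ((1 - (#|K| ^ r)%:R * expR (- (N / 24)))%:E <= P E1)%E.
    rewrite -card_tuple; apply: probability_bigcap_ge => t;
      first exact: measurableC.
    by rewrite setCK; exact: small_ball.
  have h2 : ((1 - (#|K| * 64 ^ #|I|)%:R * expR (- (8 * N)))%:E <= P E2)%E.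
    apply: (@le_trans _ _ (1 - (#|{: K * lattice I}|)%:R *
      expR (- (8 * N)))%:E).
      rewrite lee_fin lerD2l lerN2 ler_wpM2r ?expR_ge0// ler_nat card_prod.
      by rewrite leq_mul2l (card_lattice R) orbT.
    apply: probability_bigcap_ge => kl; first exact: measurableC.
    rewrite setCK; apply: bilinear_tail; last exact: D16.
    exact: lattice_vec_norm.
  exact: probability_setI_ge.
move=> w [wE1 wE2] L al f h al0 al1 hE.
have {}hE : h = (fun j => \sum_l al l * D (f l) j) by exact/funext.
pose q (z : J -> R) := \sum_i A z w i ^+ 2 - N / 6 * \sum_j z j ^+ 2.
pose e := \sum_l al l * q (D (f l)) - q h.
(* The bias-variance identity: the excess over the square at the mean does not depend on the shift
   [v], as [maurey_average] requires. *)
have sqE (v y : R) (g : L -> R) : y = \sum_l al l * g l ->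
    \sum_l al l * (v + g l) ^+ 2 =
      (v + y) ^+ 2 + (\sum_l al l * g l ^+ 2 - y ^+ 2).
  move=> yE; transitivity
    (\sum_l (al l * v ^+ 2 + (v *+ 2 * (al l * g l) + al l * g l ^+ 2))).
    by apply: eq_bigr => l _; ring.
  by rewrite !big_split/= -mulr_suml al1 -mulr_sumr -yE; ring.
have hq (v : J -> R) : \sum_l al l * q (v + D (f l)) = q (v + h) + e.
  rewrite /e /q.
  have split_q (g : L -> J -> R) :
    \sum_l al l * (\sum_i A (g l) w i ^+ 2 - N / 6 * \sum_j g l j ^+ 2) =
     \sum_i (\sum_l al l * A (g l) w i ^+ 2) - N / 6 * \sum_j \sum_l al l *
       g l j ^+ 2.
    rewrite exchange_big [X in _ - _ * X]exchange_big/= mulr_sumr -sumrB.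
    by apply: eq_bigr => l _; rewrite -!mulr_sumr; ring.
  rewrite !split_q.
  have -> : A (v + h) w = (fun i => A v w i + A h w i) by apply/funext => i;
    exact: designD.
  have EA i : \sum_l al l * A (v + D (f l)) w i ^+ 2 =
      (A v w i + A h w i) ^+ 2 +
        (\sum_l al l * A (D (f l)) w i ^+ 2 - A h w i ^+ 2).
    rewrite -(sqE _ _ (fun l => A (D (f l)) w i))//;
      last by rewrite hE design_sum.
    by apply: eq_bigr => l _; rewrite -designD.
  have EJ j : \sum_l al l * (v + D (f l)) j ^+ 2 =
      (v + h) j ^+ 2 + (\sum_l al l * D (f l) j ^+ 2 - h j ^+ 2) by apply: sqE;
        rewrite hE.
  rewrite (eq_bigr _ (fun i _ => EA i)) [X in _ - _ * X =
    _](eq_bigr _ (fun j _ => EJ j)).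
  rewrite !big_split/= !sumrN.
  ring.
have q0 : 0 <= q (0 + h *+ r) + e *+ r.
  apply: (maurey_average al0 al1 hq) => t.
  have := wE1 (map_tuple f t) Logic.I; move=> /= /negP.
  rewrite -leNgt /q subr_ge0 add0r.
  suff -> : \sum_(l <- t) D (f l) = Dt (map_tuple f t) by [].
  by apply/funext => j; rewrite /Dt big_map fct_sumE.
have qr : q (h *+ r) = r%:R ^+ 2 * q h.
  have -> : h *+ r = (fun j => r%:R * h j).
    by apply/funext => j; rewrite mulr_natl; elim: (r) => // k IH;
      rewrite !mulrS -IH.
  rewrite /q mulrBr !mulr_sumr; congr (_ - _).
    by apply: eq_bigr => i _; rewrite designZ exprMn.
  by apply: eq_bigr => j _; ring.
have eD : e <= 1600 * N - q h.
  have -> : 1600 * N = \sum_l al l * (1600 * N) by rewrite -mulr_suml al1 mul1r.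
  rewrite /e lerD2r; apply: ler_sum => l _.
  rewrite ler_wpM2l//.
  apply: (@le_trans _ _ (\sum_i A (D (f l)) w i ^+ 2)).
    rewrite /q gerBl mulr_ge0 ?divr_ge0 ?sumr_ge0// => j _; exact: sqr_ge0.
  have := @norm_le_lattice (A (D (f l)) w) (40 * Num.sqrt N).
  rewrite exprMn sqr_sqrtr// => hn; apply: le_trans (hn _ _) _.
  - by rewrite mulr_ge0 ?sqrtr_ge0.
  - by move=> la; rewrite leNgt; apply/negP; exact: (wE2 (f l, la)).
  - lra.
(* Dividing by [r] gives [0 <= r%:R * q h + e], and the bound on [e] cancels one copy of [q h]. *)
move: q0; rewrite add0r qr.
have -> : r%:R ^+ 2 * q h + e *+ r = r%:R * (r%:R * q h + e)
  by rewrite -[e *+ r]mulr_natl; ring.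
rewrite pmulr_rge0 ?ltr0n// => q0.
have : 0 <= (r%:R - 1) * q h + 1600 * N by move: eD q0;
  move: (q h) (e : R) => y z; lra.
by rewrite /q mulrBr addrAC subr_ge0.
Qed.

End restricted_lower_bound.

(** * The trace inner product and real singular frames *)

Section mxdot_theory.
Context (R : realType).

Lemma mxdotE (m n : nat) (A B : 'M[R]_(m, n)) :
  mxdot A B = \sum_i \sum_j A i j * B i j.
Proof.
rewrite /mxdot /mxtrace exchange_big/=; apply: eq_bigr => j _.
by rewrite mxE; apply: eq_bigr => i _; rewrite mxE.
Qed.

Lemma mxdotC (m n : nat) (A B : 'M[R]_(m, n)) : mxdot A B = mxdot B A.
Proof.
by rewrite !mxdotE; apply: eq_bigr => i _; apply: eq_bigr => j _; rewrite mulrC.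
Qed.

Lemma mxdotDr (m n : nat) (A B C : 'M[R]_(m, n)) :
  mxdot A (B + C) = mxdot A B + mxdot A C.
Proof. by rewrite /mxdot mulmxDr mxtraceD. Qed.

Lemma mxdotZr (m n : nat) (a : R) (A B : 'M[R]_(m, n)) :
  mxdot A (a *: B) = a * mxdot A B.
Proof. by rewrite /mxdot -scalemxAr mxtraceZ. Qed.

Lemma mxdotNr (m n : nat) (A B : 'M[R]_(m, n)) : mxdot A (- B) = - mxdot A B.
Proof. by rewrite -scaleN1r mxdotZr mulN1r. Qed.

Lemma mxdotDl (m n : nat) (A B C : 'M[R]_(m, n)) :
  mxdot (A + B) C = mxdot A C + mxdot B C.
Proof. by rewrite mxdotC mxdotDr !(mxdotC C). Qed.

Lemma mxdotZl (m n : nat) (a : R) (A B : 'M[R]_(m, n)) :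
  mxdot (a *: A) B = a * mxdot A B.
Proof. by rewrite mxdotC mxdotZr mxdotC. Qed.

Lemma mxdotNl (m n : nat) (A B : 'M[R]_(m, n)) : mxdot (- A) B = - mxdot A B.
Proof. by rewrite mxdotC mxdotNr mxdotC. Qed.

Lemma mxdot0r (m n : nat) (A : 'M[R]_(m, n)) : mxdot A 0 = 0.
Proof. by rewrite /mxdot mulmx0 mxtrace0. Qed.

Lemma mxdot_sumr (m n : nat) (A : 'M[R]_(m, n)) (K : finType) (P : pred K)
    (F : K -> 'M[R]_(m, n)) :
  mxdot A (\sum_(k | P k) F k) = \sum_(k | P k) mxdot A (F k).
Proof. exact: (big_morph _ (mxdotDr A) (mxdot0r A)). Qed.

Lemma mxdot_suml (m n : nat) (A : 'M[R]_(m, n)) (K : finType) (P : pred K)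
    (F : K -> 'M[R]_(m, n)) :
  mxdot (\sum_(k | P k) F k) A = \sum_(k | P k) mxdot (F k) A.
Proof. by rewrite mxdotC mxdot_sumr; under eq_bigr do rewrite mxdotC. Qed.

Lemma mxdot_mull (m n p : nat) (A : 'M[R]_(m, p)) (B : 'M[R]_(p, n)) C :
  mxdot (A *m B) C = mxdot B (A^T *m C).
Proof. by rewrite /mxdot trmx_mul mulmxA. Qed.

Lemma mxdot_mulr (m n p : nat) (A : 'M[R]_(m, p)) (B : 'M[R]_(p, n)) C :
  mxdot (A *m B) C = mxdot A (C *m B^T).
Proof. by rewrite /mxdot trmx_mul -mulmxA mxtrace_mulC -mulmxA. Qed.

Lemma mxdot_tr (m n : nat) (A B : 'M[R]_(m, n)) : mxdot A^T B^T = mxdot A B.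
Proof. by rewrite /mxdot mxtrace_mulC -trmx_mul mxtrace_tr. Qed.

Lemma mxdot_ge0 (m n : nat) (A : 'M[R]_(m, n)) : 0 <= mxdot A A.
Proof.
by rewrite mxdotE; apply: sumr_ge0 => i _; apply: sumr_ge0 => j _;
  rewrite -expr2 sqr_ge0.
Qed.

Lemma mxdot_eq0 (m n : nat) (A : 'M[R]_(m, n)) : mxdot A A = 0 -> A = 0.
Proof.
rewrite mxdotE => /eqP; rewrite psumr_eq0; last first.
  by move=> i _; apply: sumr_ge0 => j _; rewrite -expr2 sqr_ge0.
move=> /allP A0; apply/matrixP => i j; rewrite mxE.
have /implyP/(_ isT) := A0 i (mem_index_enum i).
rewrite psumr_eq0; last by move=> k _; rewrite -expr2 sqr_ge0.
move=> /allP/(_ j (mem_index_enum j))/implyP/(_ isT).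
by rewrite -expr2 sqrf_eq0 => /eqP.
Qed.

Lemma frobenius_norm_sq (m n : nat) (A : 'M[R]_(m, n)) :
  frobenius_norm A ^+ 2 = mxdot A A.
Proof. by rewrite sqr_sqrtr// mxdot_ge0. Qed.

Lemma frobenius_norm_ge0 (m n : nat) (A : 'M[R]_(m, n)) : 0 <= frobenius_norm A.
Proof. exact: sqrtr_ge0. Qed.

Lemma mxdot_le (m n : nat) (A B : 'M[R]_(m, n)) :
  mxdot A B <= frobenius_norm A * frobenius_norm B.
Proof.
have [B0|B0] := eqVneq (mxdot B B) 0.
  by rewrite (mxdot_eq0 B0) mxdot0r mulr_ge0 ?sqrtr_ge0.
have {}B0 : 0 < mxdot B B by rewrite lt_neqAle eq_sym B0 mxdot_ge0.
rewrite -sqrtrM ?mxdot_ge0// (le_trans (ler_norm _))// -sqrtr_sqr ler_wsqrtr//.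
have := mxdot_ge0 (mxdot B B *: A - mxdot A B *: B).
rewrite mxdotDl !mxdotDr !mxdotNl !mxdotNr !mxdotZl !mxdotZr (mxdotC B A).
set a := mxdot A A; set b := mxdot A B; set c := mxdot B B in B0 *.
rewrite [X in 0 <= X](_ : _ = c * (a * c - b ^+ 2)); last by ring.
by rewrite pmulr_rge0// subr_ge0.
Qed.

End mxdot_theory.

Section singular_frame.
Local Open Scope sesquilinear_scope.
Context (R : realType).
Implicit Types (x y : R[i]).

Lemma complex_ReD x y : complex.Re (x + y) = complex.Re x + complex.Re y.
Proof. by case: x; case: y. Qed.

Lemma complex_ImD x y : complex.Im (x + y) = complex.Im x + complex.Im y.
Proof. by case: x; case: y. Qed.

Lemma complex_Re_sum (K : finType) (F : K -> R[i]) :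
  complex.Re (\sum_k F k) = \sum_k complex.Re (F k).
Proof. exact: (big_morph _ complex_ReD). Qed.

Lemma complex_Im_sum (K : finType) (F : K -> R[i]) :
  complex.Im (\sum_k F k) = \sum_k complex.Im (F k).
Proof. exact: (big_morph _ complex_ImD). Qed.

Lemma complex_Re_conjM x y :
  complex.Re (x^* * y) = complex.Re x * complex.Re y + complex.Im x *
    complex.Im y.
Proof. by case: x; case: y => a b c e /=; rewrite mulNr opprK. Qed.

Lemma complex_Re_conj x : complex.Re x^* = complex.Re x.
Proof. by case: x. Qed.

Lemma complex_Im_conj x : complex.Im x^* = - complex.Im x.
Proof. by case: x. Qed.

Lemma complex_Re_realM (a : R) x : complex.Re (real_complex R a * x) =
  a * complex.Re x.
Proof. by case: x => b c /=; rewrite mul0r subr0. Qed.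

Lemma complex_Im_realM (a : R) x : complex.Im (real_complex R a * x) =
  a * complex.Im x.
Proof. by case: x => b c /=; rewrite mul0r addr0. Qed.

(* The real and imaginary parts of the complex eigenvectors of a real symmetric
   matrix form a real tight frame of eigenvectors. *)
Lemma spectral_frame (n : nat) (M : 'M[R]_n) : M^T = M ->
  exists f : 'I_n * bool -> 'cV[R]_n,
  [/\ \sum_k f k *m (f k)^T = 1%:M,
      forall k, M *m f k =
        complex.Re (spectral_diag (map_mx (real_complex R) M) ord0 k.1) *: f k &
      forall j, \sum_c mxdot (f (j, c)) (f (j, c)) = 1].
Proof.
move=> MT; pose Mc := map_mx (real_complex R) M.
have Mherm : Mc \is hermsymmx.
  apply/is_hermitianmxP; rewrite expr0 scale1r.
  apply/matrixP => i j; rewrite !mxE -{1}MT mxE.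
  by apply/eqP; rewrite eq_complex /= oppr0 !eqxx.
have /hermitian_normalmx /orthomx_spectralP := Mherm.
rewrite -/Mc; set Pc := spectralmx Mc; set D := spectral_diag Mc.
have PU : Pc \is unitarymx := spectral_unitarymx Mc.
rewrite invmx_unitary// => ME.
pose del j := complex.Re (D ord0 j).
have DE j : D ord0 j = real_complex R (del j).
  have /mxOverP/(_ ord0 j) := hermitian_spectral_diag_real Mherm.
  by move=> /RRe_real ->.
(* The conjugated rows of [Pc] are eigenvectors with real eigenvalues. As [M] is real, their real
   and imaginary parts satisfy the same equation; such a part may vanish, and only the pair has
   total squared norm one. *)
pose f (k : 'I_n * bool) : 'cV[R]_n := \col_i
  (if k.2 then complex.Re (Pc k.1 i) else complex.Im (Pc k.1 i)).
exists f; split.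
- apply/matrixP => i j.
  have : Pc ^t* *m Pc = 1%:M by apply: mulmx1C; exact/unitarymxP.
  move=> /matrixP/(_ i j)/(congr1 (@complex.Re R)).
  rewrite !mxE complex_Re_sum => h.
  transitivity (complex.Re ((i == j)%:R : R[i])); last by case: eqP.
  rewrite -h summxE -(pair_bigA _ (fun k c =>
    (f (k, c) *m (f (k, c))^T) i j))/=.
  apply: eq_bigr => k _; rewrite big_bool !mxE !big_ord1 !mxE/=.
  by rewrite complex_Re_conjM.
- move=> k; have : Mc *m Pc^t* = Pc^t* *m diag_mx D.
    by rewrite {1}ME -!mulmxA (unitarymxP PU) mulmx1.
  move=> /matrixP h; apply/matrixP => i z; rewrite ord1 {z}.
  have := h i k.1; rewrite mul_mx_diag !mxE DE.
  under eq_bigr do rewrite !mxE.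
  rewrite mulrC => e.
  case: k e => j c /= e.
  have eRe : \sum_l M i l * complex.Re (Pc j l) = del j * complex.Re (Pc j i).
    move: (congr1 (@complex.Re R) e).
    rewrite complex_Re_sum complex_Re_realM complex_Re_conj => <-.
    by apply: eq_bigr => l _; rewrite complex_Re_realM complex_Re_conj.
  have eIm : \sum_l M i l * complex.Im (Pc j l) = del j * complex.Im (Pc j i).
    move: (congr1 (@complex.Im R) e).
    rewrite complex_Im_sum complex_Im_realM complex_Im_conj mulrN.
    move=> /(congr1 -%R); rewrite opprK => <-; rewrite -sumrN.
    by apply: eq_bigr => l _;
      rewrite complex_Im_realM complex_Im_conj mulrN opprK.
  by case: c; [rewrite -eRe|rewrite -eIm]; apply: eq_bigr => l _; rewrite mxE.
- move=> j.
  have /(congr1 (fun B : 'M[R[i]]_n => complex.Re (B j j))) := unitarymxP PU.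
  rewrite !mxE eqxx complex_Re_sum => h;
    rewrite -[RHS]h big_bool !mxdotE -big_split/=.
  by apply: eq_bigr => i _;
    rewrite !big_ord1 !mxE [Pc j i * _]mulrC complex_Re_conjM.
Qed.

Lemma singular_frame (m n : nat) (A : 'M[R]_(m, n)) :
  exists f : 'I_n * bool -> 'cV[R]_n,
  [/\ \sum_k f k *m (f k)^T = 1%:M,
      forall k, A^T *m (A *m f k) = singular_value A k.1 ^+ 2 *: f k &
      forall j, \sum_c mxdot (f (j, c)) (f (j, c)) = 1].
Proof.
have [|f [f1 fM fn]] := @spectral_frame n (A^T *m A).
  by rewrite trmx_mul trmxK.
exists f; split=> // k; rewrite mulmxA fM; congr (_ *: _).
rewrite /singular_value sqr_sqrtr//; set del := complex.Re _.
(* The eigenvalue is nonnegative, so squaring its root recovers it: weighted by the pair's total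
   squared norm one, it is a sum of squared norms of [A *m f (k.1, c)]. *)
rewrite -[del]mulr1 -(fn k.1) mulr_sumr; apply: sumr_ge0 => c _.
have <- : mxdot (f (k.1, c)) (A^T *m A *m f (k.1, c)) =
  del * mxdot (f (k.1, c)) (f (k.1, c)).
  by rewrite fM mxdotZr.
by rewrite -mulmxA -mxdot_mull mxdot_ge0.
Qed.

End singular_frame.

(** * Nuclear norm duality *)

Section nuclear_norm_theory.
Context (R : realType).

(** The unit ball of the operator norm, which is dual to the nuclear norm. *)
Definition contraction (m n : nat) (W : 'M[R]_(m, n)) : Prop :=
  forall v : 'cV[R]_n, mxdot (W *m v) (W *m v) <= mxdot v v.

Lemma mxdot_outer (m n : nat) (u : 'cV[R]_m) (v : 'cV[R]_n) :
  mxdot (u *m v^T) (u *m v^T) = mxdot u u * mxdot v v.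
Proof.
rewrite !mxdotE mulr_suml; apply: eq_bigr => i _; rewrite big_ord1 mulr_sumr.
by apply: eq_bigr => j _; rewrite !mxE !big_ord1 !mxE; ring.
Qed.

Lemma mxdot_le1 (m n : nat) (A B : 'M[R]_(m, n)) :
  mxdot A A <= 1 -> mxdot B B <= 1 -> mxdot A B <= 1.
Proof.
move=> A1 B1; apply: (le_trans (mxdot_le A B)).
by rewrite mulr_ile1 ?sqrtr_ge0// -sqrtr1 ler_wsqrtr.
Qed.

Lemma nuclear_norm_ge0 (m n : nat) (A : 'M[R]_(m, n)) : 0 <= nuclear_norm A.
Proof. by apply: sumr_ge0 => j _; exact: sqrtr_ge0. Qed.

Lemma nuclear_frame (m n : nat) (A : 'M[R]_(m, n)) :
  exists (s : 'I_n * bool -> R) (f : 'I_n * bool -> 'cV[R]_n),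
  [/\ forall k, 0 <= s k, \sum_k f k *m (f k)^T = 1%:M,
      forall k, A^T *m (A *m f k) = s k ^+ 2 *: f k &
      nuclear_norm A = \sum_k s k * mxdot (f k) (f k)].
Proof.
have [f [f1 fM fn]] := singular_frame A.
exists (fun k => singular_value A k.1), f; split => //.
  by move=> k; exact: sqrtr_ge0.
transitivity (\sum_j \sum_c singular_value A j * mxdot (f (j, c)) (f (j, c))).
  by apply: eq_bigr => j _; rewrite -mulr_sumr fn mulr1.
by rewrite pair_bigA; apply: eq_bigr => -[].
Qed.

Lemma nuclear_decomposition (m n : nat) (A : 'M[R]_(m, n)) :
  exists (s : 'I_n * bool -> R) (u : 'I_n * bool -> 'cV[R]_m)
    (v : 'I_n * bool -> 'cV[R]_n),
  [/\ forall k, [/\ 0 <= s k, mxdot (u k) (u k) <= 1 & mxdot (v k) (v k) <= 1],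
      A = \sum_k s k *: (u k *m (v k)^T) & nuclear_norm A = \sum_k s k].
Proof.
have [s [f [s0 f1 fM nE]]] := nuclear_frame A.
pose a k := frobenius_norm (f k).
have a2 k : a k ^+ 2 = mxdot (f k) (f k) by exact: frobenius_norm_sq.
have a0 k : 0 <= a k by exact: frobenius_norm_ge0.
have AfE k : mxdot (A *m f k) (A *m f k) = (s k * a k) ^+ 2.
  by rewrite mxdot_mull fM mxdotZr exprMn a2.
have unit1 (x : R) : x ^- 2 * x ^+ 2 <= 1.
  by have [->|x0] := eqVneq x 0; rewrite ?expr0n ?mulr0// mulVf ?expf_neq0.
(* Since the inverse of 0 is 0, a degenerate vector is sent to 0; hence norms at most one rather
   than equal to one. *)
exists (fun k => s k * a k ^+ 2), (fun k => (s k * a k)^-1 *: (A *m f k)),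
  (fun k => (a k)^-1 *: f k); split.
- move=> k; split; first by rewrite mulr_ge0// sqr_ge0.
    by rewrite mxdotZl mxdotZr AfE mulrA -expr2 exprVn unit1.
  by rewrite mxdotZl mxdotZr -a2 mulrA -expr2 exprVn unit1.
- rewrite -[LHS]mulmx1 -f1 mulmx_sumr; apply: eq_bigr => k _.
  rewrite linearZ /= -scalemxAl -scalemxAr !scalerA mulmxA.
  have [sa0|sa0] := eqVneq (s k * a k) 0.
    have -> : A *m f k = 0 by apply: mxdot_eq0; rewrite AfE sa0 expr0n.
    by rewrite mul0mx scaler0.
  rewrite (_ : _ * _ = 1) ?scale1r//.
  move: sa0; rewrite mulf_eq0 negb_or => /andP[sn0 an0].
  by field; rewrite sn0 an0.
- by rewrite nE; under eq_bigr do rewrite -a2.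
Qed.

Lemma contraction_le_nuclear (m n : nat) (W A : 'M[R]_(m, n)) :
  contraction W -> mxdot W A <= nuclear_norm A.
Proof.
move=> hW; have [s [u [v [h -> ->]]]] := nuclear_decomposition A.
rewrite mxdot_sumr; apply: ler_sum => k _; have [s0 u1 v1] := h k.
rewrite mxdotZr ler_piMr// mxdotC mxdot_mulr trmxK.
by apply: mxdot_le1 => //; exact: le_trans (hW _) v1.
Qed.

(** [W] is the polar factor of [A], written in the frame. It acts isometrically on the span of the
    frame vectors with nonzero singular value and kills the others. *)
Lemma nuclear_dual (m n : nat) (A : 'M[R]_(m, n)) :
  exists2 W : 'M[R]_(m, n), contraction W & mxdot W A = nuclear_norm A.
Proof.
have [s [f [s0 f1 fM nE]]] := nuclear_frame A.
pose W := \sum_k (s k)^-1 *: (A *m f k *m (f k)^T).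
have AfE k l : mxdot (A *m f k) (A *m f l) = s l ^+ 2 * mxdot (f k) (f l).
  by rewrite mxdot_mull fM mxdotZr.
(* Eigenvectors of the symmetric matrix [A^T *m A] for distinct eigenvalues are orthogonal; within
   one eigenvalue the frame vectors need not be. *)
have fperp k l : s k != s l -> mxdot (f k) (f l) = 0.
  move=> skl; have : s l ^+ 2 * mxdot (f k) (f l) =
    s k ^+ 2 * mxdot (f k) (f l).
    by rewrite -AfE mxdotC AfE mxdotC.
  move/eqP; rewrite -subr_eq0 -mulrBl mulf_eq0 subr_eq0 => /orP[|/eqP//].
  by rewrite eqrXn2// eq_sym (negPf skl).
exists W.
  move=> x; pose c k := mxdot (f k) x.
  pose y := \sum_(k | s k != 0) c k *: f k.
  pose z := \sum_(k | s k == 0) c k *: f k.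
  have fx k : (f k)^T *m x = (c k)%:M.
    by rewrite [LHS]mx11_scalar /c /mxdot /mxtrace big_ord1.
  have ffx k : f k *m ((f k)^T *m x) = c k *: f k by rewrite fx mul_mx_scalar.
  have xE : x = y + z.
    rewrite -[LHS]mul1mx -f1 mulmx_suml (bigID (fun k => s k != 0))/=.
    by congr (_ + _); apply: eq_big => k; rewrite ?negbK// => _;
      rewrite -mulmxA; rewrite (fx k) mul_mx_scalar.
  have yz : mxdot y z = 0.
    rewrite mxdot_suml big1// => k sk; rewrite mxdot_sumr big1// => l /eqP sl.
    by rewrite mxdotZl mxdotZr fperp ?mulr0// sl.
  have -> : W *m x = \sum_(k | s k != 0) ((s k)^-1 * c k) *: (A *m f k).
    rewrite mulmx_suml [RHS]big_mkcond/=; apply: eq_bigr => k _.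
    rewrite -scalemxAl -!mulmxA ffx -scalemxAr scalerA.
    by case: eqP => // ->; rewrite invr0 mul0r scale0r.
  have -> : mxdot x x = mxdot y y + mxdot z z.
    by rewrite xE mxdotDl !mxdotDr (mxdotC z y) yz addr0 add0r.
  apply: (@le_trans _ _ (mxdot y y)); last by rewrite lerDl mxdot_ge0.
  rewrite /y !mxdot_suml; apply: ler_sum => k sk.
  rewrite !mxdot_sumr; apply: ler_sum => l sl.
  rewrite !mxdotZl !mxdotZr AfE.
  have [skl|/fperp ->] := eqVneq (s k) (s l); last by rewrite !mulr0.
  rewrite skl le_eqVlt; apply/orP; left; apply/eqP.
  by field; rewrite -skl.
rewrite mxdot_suml nE; apply: eq_bigr => k _.
rewrite mxdotZl mxdot_mulr trmxK AfE.
have [->|sk] := eqVneq (s k) 0; first by rewrite invr0 !mul0r.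
by field.
Qed.

(** By Cauchy-Schwarz, |W^T y|^2 = <W W^T y, y> <= |W^T y| |y|. *)
Lemma contraction_tr (m n : nat) (W : 'M[R]_(m, n)) : contraction W ->
  contraction W^T.
Proof.
move=> hW y; set a := mxdot _ _.
have h : a <= Num.sqrt a * frobenius_norm y.
  rewrite {1}/a mxdot_mull trmxK mxdotC.
  by rewrite (le_trans (mxdot_le _ _))// ler_wpM2r ?sqrtr_ge0// ler_wsqrtr.
have a0 : 0 <= a by exact: mxdot_ge0.
rewrite -frobenius_norm_sq -[a]sqr_sqrtr//.
move: h; rewrite -{1}[a]sqr_sqrtr//.
have := sqrtr_ge0 a; have := frobenius_norm_ge0 y.
move: (Num.sqrt a) (frobenius_norm y) => b c c0 b0 h.
have [->|b1] := eqVneq b 0; first by rewrite expr0n sqr_ge0.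
have {}b1 : 0 < b by rewrite lt_neqAle eq_sym b1.
by rewrite lerXn2r// -(ler_pM2l b1) -expr2.
Qed.

Lemma contractionM (m n p : nat) (A : 'M[R]_(m, n)) (B : 'M[R]_(n, p)) :
  contraction A -> contraction B -> contraction (A *m B).
Proof.
move=> hA hB v; rewrite -!mulmxA; exact: le_trans (hA _) (hB _).
Qed.

Lemma contraction_mul_le (m n p : nat) (W : 'M[R]_(m, n)) (Q : 'M[R]_(n, p)) :
  contraction W -> mxdot (W *m Q) (W *m Q) <= mxdot Q Q.
Proof.
move=> hW.
have cols (k : nat) (B : 'M[R]_(k, p)) : mxdot B B =
  \sum_j mxdot (col j B) (col j B).
  rewrite mxdotE exchange_big/=; apply: eq_bigr => j _; rewrite mxdotE.
  by apply: eq_bigr => i _; rewrite big_ord1 !mxE.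
rewrite !cols; apply: ler_sum => j _.
by rewrite !colE -mulmxA; exact: hW.
Qed.

Lemma contraction_frobenius (m n : nat) (W : 'M[R]_(m, n)) :
  contraction W -> mxdot W W <= (minn m n)%:R.
Proof.
have aux k l (V : 'M[R]_(k, l)) : contraction V -> mxdot V V <= l%:R.
  move=> hV; rewrite -[V]mulmx1 (le_trans (contraction_mul_le _ hV))//.
  by rewrite /mxdot mulmx1 trmx1 mxtrace1.
move=> hW; rewrite /minn; case: ifP => _; last exact: aux.
by rewrite -mxdot_tr; apply: aux; exact: contraction_tr.
Qed.

Lemma nuclear_le_frobenius (m n : nat) (A : 'M[R]_(m, n)) :
  nuclear_norm A <= Num.sqrt (minn m n)%:R * frobenius_norm A.
Proof.
have [W hW <-] := nuclear_dual A.
rewrite (le_trans (mxdot_le _ _))// ler_wpM2r ?sqrtr_ge0// ler_wsqrtr//.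
exact: contraction_frobenius.
Qed.

(** Pair [A] with its own decomposition: each rank-one term has Frobenius norm at most one, so |A|^2
    is at most |A| times the sum of the weights. *)
Lemma frobenius_le_nuclear (m n : nat) (A : 'M[R]_(m, n)) :
  frobenius_norm A <= nuclear_norm A.
Proof.
have h : mxdot A A <= frobenius_norm A * nuclear_norm A.
  have [s [u [v [h AE ->]]]] := nuclear_decomposition A.
  rewrite {2}AE mxdot_sumr mulr_sumr; apply: ler_sum => k _.
  have [s0 u1 v1] := h k; rewrite mxdotZr mulrC ler_wpM2r//.
  rewrite (le_trans (mxdot_le _ _))// ler_piMr ?sqrtr_ge0//.
  by rewrite /frobenius_norm mxdot_outer -sqrtr1 ler_wsqrtr// mulr_ile1
    ?mxdot_ge0.
have [->|A0] := eqVneq (frobenius_norm A) 0; first exact: nuclear_norm_ge0.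
have {}A0 : 0 < frobenius_norm A
  by rewrite lt_neqAle eq_sym A0 frobenius_norm_ge0.
by move: h; rewrite -frobenius_norm_sq expr2 ler_pM2l.
Qed.

(** [P] is the orthogonal projection B (B^T B)^-1 B^T onto the column space, with [B] of full column
    rank; its squared Frobenius norm is its trace. *)
Lemma col_projection (m n : nat) (H : 'M[R]_(m, n)) :
  exists P : 'M[R]_m,
    [/\ P^T = P, P *m P = P, P *m H = H & mxdot P P = (\rank H)%:R].
Proof.
have [B Bfree [C HE]] : exists2 B : 'M[R]_(m, \rank H), row_free B^T &
    exists C, H = B *m C.
  exists (col_base H); first by rewrite /row_free mxrank_tr;
    exact: col_base_full.
  by exists (row_base H); rewrite mulmx_base.
pose G := B^T *m B.
have GU : G \in unitmx.
  rewrite -row_free_unit; apply: inj_row_free => v vG.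
  apply: (row_free_inj Bfree); rewrite mul0mx; apply: trmx_inj.
  rewrite trmx_mul trmxK trmx0; apply: mxdot_eq0.
  rewrite mxdot_mull mulmxA -/G.
  by rewrite /mxdot trmxK mulmxA vG mul0mx mxtrace0.
have GT : G^T = G by rewrite /G trmx_mul trmxK.
pose P := B *m invmx G *m B^T.
have PT : P^T = P by rewrite /P !trmx_mul trmxK trmx_inv GT mulmxA.
have PB : P *m B = B by rewrite /P -!mulmxA -/G mulVmx ?mulmx1.
have PP : P *m P = P by rewrite {2}/P !mulmxA PB.
exists P; split => //; first by rewrite {1}HE mulmxA PB -HE.
rewrite /mxdot PT PP /P -mulmxA mxtrace_mulC -mulmxA -/G.
by rewrite mulVmx// mxtrace1.
Qed.

Section projection.
Context (n : nat) (P : 'M[R]_n).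
Hypotheses (PT : P^T = P) (PP : P *m P = P).

Lemma projection_compl : (1%:M - P)^T = 1%:M - P /\
  (1%:M - P) *m (1%:M - P) = 1%:M - P.
Proof.
split; first by rewrite linearB/= trmx1 PT.
by rewrite mulmxBr mulmx1 mulmxBl mul1mx PP subrr subr0.
Qed.

Lemma projection_pythagoras (v : 'cV[R]_n) :
  mxdot v v = mxdot (P *m v) (P *m v) +
    mxdot ((1%:M - P) *m v) ((1%:M - P) *m v).
Proof.
have [QT QQ] := projection_compl.
rewrite mxdot_mull PT mulmxA PP mxdot_mull QT mulmxA QQ -mxdotDr.
by rewrite -mulmxDl addrC subrK mul1mx.
Qed.

Lemma projection_contraction : contraction P.
Proof. by move=> v; rewrite [leRHS]projection_pythagoras lerDl mxdot_ge0. Qed.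

End projection.

(* Decomposability of the nuclear norm: off the row and column spaces of [H] a
   dual certificate of [H] can be completed by one of the perturbation. *)
Lemma nuclear_cone (m n : nat) (H D : 'M[R]_(m, n)) (gam : R) :
  nuclear_norm (H + D) <= nuclear_norm H + gam ->
  nuclear_norm D <= 3 * (Num.sqrt (\rank H)%:R * frobenius_norm D) + gam.
Proof.
move=> hHD; set r := Num.sqrt _.
have [P [PT PP PH Pr]] := col_projection H.
have [Q [QT QQ QH Qr]] := col_projection H^T.
have {QH}HQ : H *m Q = H by rewrite -[LHS]trmxK trmx_mul QT QH trmxK.
have [PT' PP'] := projection_compl PT PP.
have [QT' QQ'] := projection_compl QT QQ.
have cP := projection_contraction PT PP.
have cQ := projection_contraction QT QQ.
have cP' := projection_contraction PT' PP'.
have cQ' := projection_contraction QT' QQ'.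
have fP W : contraction W -> frobenius_norm (P *m W) <= r.
  move=> hW; rewrite ler_wsqrtr// -Pr -mxdot_tr trmx_mul PT.
  exact/contraction_mul_le/contraction_tr.
have fQ W : contraction W -> frobenius_norm (W *m Q) <= r.
  move=> hW; rewrite ler_wsqrtr// -mxrank_tr -Qr.
  exact: contraction_mul_le.
have [W1 c1 W1E] := nuclear_dual H.
set P' := 1%:M - P in PT' PP' cP' *; set Q' := 1%:M - Q in QT' QQ' cQ' *.
have PP'0 : P *m P' = 0 by rewrite mulmxBr mulmx1 PP subrr.
have P'P0 : P' *m P = 0 by rewrite mulmxBl mul1mx PP subrr.
pose Dp := P' *m D *m Q'.
have [W2 c2 W2E] := nuclear_dual Dp.
have [W3 c3 W3E] := nuclear_dual D.
have d0 := frobenius_norm_ge0 D.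
(* The two blocks have orthogonal ranges and act on the complementary components [Q *m x] and
   [Q' *m x], so their squared norms add up to at most that of [x]. *)
have cW : contraction (P *m W1 *m Q + P' *m W2 *m Q').
  move=> x; rewrite mulmxDl.
  set a := P *m W1 *m Q *m x; set b := P' *m W2 *m Q' *m x.
  have ab : mxdot a b = 0.
    by rewrite /a /b -!mulmxA mxdot_mull PT [P *m (P' *m _)]mulmxA PP'0 mul0mx
      mxdot0r.
  rewrite mxdotDl !mxdotDr (mxdotC b a) ab addr0 add0r.
  rewrite [leRHS](projection_pythagoras QT QQ); apply: lerD.
    by rewrite /a -mulmxA; apply: (contractionM cP c1).
  by rewrite /b -mulmxA; apply: (contractionM cP' c2).
have e1 : mxdot (P *m W1 *m Q) H = nuclear_norm H.
  by rewrite mxdot_mulr QT HQ mxdot_mull PT PH.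
have e2 : mxdot (P' *m W2 *m Q') H = 0.
  by rewrite mxdot_mulr QT' mulmxBr mulmx1 HQ subrr mxdot0r.
have e3 : mxdot (P' *m W2 *m Q') D = nuclear_norm Dp.
  by rewrite mxdot_mulr QT' mxdot_mull PT' mulmxA.
have e4 : - (r * frobenius_norm D) <= mxdot (P *m W1 *m Q) D.
  rewrite lerNl -mxdotNl (le_trans (mxdot_le _ _))// ler_wpM2r//.
  rewrite /frobenius_norm mxdotNl mxdotNr opprK.
  by apply: fQ; exact: contractionM.
have := contraction_le_nuclear (H + D) cW.
rewrite mxdotDr !mxdotDl e1 e2 e3 => h.
(* Each of the first two pieces costs one [r * frobenius_norm D]. The third costs the same once more
   plus [gam], by the certificate; this is the factor 3. *)
have DE : D = P *m D + P' *m D *m Q + Dp.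
  have P1 : P + P' = 1%:M by rewrite addrC subrK.
  have Q1 : Q + Q' = 1%:M by rewrite addrC subrK.
  by rewrite /Dp -addrA -mulmxDr Q1 mulmx1 -mulmxDl P1 mul1mx.
have h1 : mxdot W3 (P *m D) <= r * frobenius_norm D.
  rewrite mxdotC mxdot_mull PT mxdotC (le_trans (mxdot_le _ _))// ler_wpM2r//.
  exact: fP.
have h2 : mxdot W3 (P' *m D *m Q) <= r * frobenius_norm D.
  rewrite mxdotC mxdot_mulr QT mxdot_mull PT' mulmxA mxdotC.
  rewrite (le_trans (mxdot_le _ _))// ler_wpM2r//.
  by apply: fQ; exact: contractionM.
have h3 : mxdot W3 Dp <= nuclear_norm Dp by exact: contraction_le_nuclear.
rewrite -W3E {1}DE !mxdotDr; lra.
Qed.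

(** The lower bound makes the Gram matrix [G] invertible, and g = A^* G^-1 xi has |g|^2 = <la, xi> =
    c. Then [kap * a <= c] and [c ^+ 2 <= a * b] give [kap * c <= b]. *)
Lemma least_norm_interpolant (n p1 p2 : nat) (X : 'I_n -> 'M[R]_(p1, p2))
    (kap : R) :
  0 < kap ->
  (forall la : 'rV[R]_n, kap * \sum_i la 0 i ^+ 2 <=
     mxdot (\sum_i la 0 i *: X i) (\sum_i la 0 i *: X i)) ->
  forall xi : 'rV[R]_n, exists2 g : 'M[R]_(p1, p2),
    forall i, mxdot (X i) g = xi 0 i & kap * mxdot g g <= mxdot xi xi.
Proof.
move=> k0 hX xi; pose G := \matrix_(i, j) mxdot (X i) (X j).
have sq (v : 'rV[R]_n) : \sum_i v 0 i ^+ 2 = mxdot v v.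
  by rewrite mxdotE big_ord1; under eq_bigr do rewrite expr2.
have GE (v : 'rV[R]_n) j : (v *m G) 0 j = mxdot (X j) (\sum_i v 0 i *: X i).
  rewrite mxE mxdot_sumr; apply: eq_bigr => i _.
  by rewrite mxE mxdotZr mxdotC.
have dotG (v : 'rV[R]_n) : mxdot (\sum_i v 0 i *: X i) (\sum_i v 0 i *: X i) =
    mxdot v (v *m G).
  rewrite mxdot_suml mxdotE big_ord1; apply: eq_bigr => i _.
  by rewrite GE mxdotZl.
have GU : G \in unitmx.
  rewrite -row_free_unit; apply: inj_row_free => v vG; apply: mxdot_eq0.
  apply/eqP; rewrite eq_le mxdot_ge0 andbT.
  by have := hX v; rewrite dotG vG mxdot0r sq pmulr_rle0.
pose la := xi *m invmx G.
have laG : la *m G = xi by rewrite mulmxKV.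
exists (\sum_i la 0 i *: X i); first by move=> i; rewrite -GE laG.
have := hX la; rewrite dotG laG sq => h.
have := mxdot_le la xi; rewrite /frobenius_norm.
have := mxdot_ge0 la; have := mxdot_ge0 xi.
set a := mxdot la la in h *; set b := mxdot xi xi; set c := mxdot la xi in h *.
move=> b0 a0 hc.
have c0 : 0 <= c by rewrite (le_trans _ h)// mulr_ge0// ltW.
have c2 : c ^+ 2 <= a * b.
  by rewrite -[leRHS]sqr_sqrtr ?mulr_ge0// sqrtrM// lerXn2r ?nnegrE ?mulr_ge0
    ?sqrtr_ge0.
have [->|cn0] := eqVneq c 0; first by rewrite mulr0.
have {}cn0 : 0 < c by rewrite lt_neqAle eq_sym cn0.
rewrite -(ler_pM2l cn0); nra.
Qed.

End nuclear_norm_theory.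

(** * Gaussian matrix entries *)

Section gaussian_entries.
Context (R : realType) (d : measure_display) (T : measurableType d)
  (P : probability T R) (n p1 p2 : nat)
  (X : 'I_n -> {RV P >-> borel_mx R p1 p2}).
Hypothesis X_indep : mutually_independent P (fun (i : 'I_n) (w : T) => X i w).
Hypothesis X_gauss : forall i : 'I_n, standard_gaussian_mx P (X i).

Lemma measurable_entry (j : 'I_p1) (k : 'I_p2) :
  measurable_fun setT (fun A : borel_mx R p1 p2 => (A : 'M[R]_(p1, p2)) j k).
Proof.
apply: (measurability _ (RGenOpens.measurableE R)) => //.
move=> _ [_ [a [b ->]] <-]; rewrite setTI.
apply: sub_sigma_algebra.
have /continuousP := @coord_continuous R p1 p2 j k.
by apply; exact: interval_open.
Qed.

Definition entry (i : 'I_n) (jk : 'I_p1 * 'I_p2) (w : T) : R := X i w jk.1 jk.2.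

Lemma measurable_entry_RV i jk : measurable_fun setT (entry i jk).
Proof. exact: (measurableT_comp (measurable_entry jk.1 jk.2)). Qed.

(** The constraints on the entries of one matrix are bundled into a Borel set [C i]. Independence
    between matrices splits off these sets, and independence within a matrix splits each of them. *)
Lemma entries_indep (B : 'I_n * ('I_p1 * 'I_p2) -> set (measurableTypeR R)) :
  (forall k, measurable (B k)) ->
  P (\bigcap_k (entry k.1 k.2 @^-1` B k)) = (\prod_k normal_prob 0 1 (B k))%E.
Proof.
move=> mB.
pose C (i : 'I_n) : set (borel_mx R p1 p2) :=
  \bigcap_jk [set A | B (i, jk) ((A : 'M[R]_(p1, p2)) jk.1 jk.2)].
have mC i : measurable (C i).
  apply: fin_bigcap_measurable.
    exact: (@finite_finset ('I_p1 * 'I_p2)%type).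
  move=> jk _; rewrite -[X in measurable X]setTI.
  exact: (@measurable_entry jk.1 jk.2 measurableT _ (mB (i, jk))).
have := @X_indep [set: 'I_n]%SET C (fun i _ => mC i).
have -> : \bigcap_(i in [set` [set: 'I_n]%SET]) ((fun w => X i w) @^-1` C i) =
    \bigcap_k (entry k.1 k.2 @^-1` B k).
  apply/seteqP; split=> w h.
    by move=> [i jk] _; have := h i; rewrite /= inE => /(_ isT jk Logic.I).
  by move=> i _ jk _; exact: (h (i, jk) Logic.I).
move=> ->.
transitivity (\prod_i \prod_jk normal_prob 0 1 (B (i, jk)))%E; last first.
  by rewrite pair_bigA; apply: eq_bigr => -[].
apply: eq_big => [i|i _]; first by rewrite inE.
have [ind law] := X_gauss i.
have := ind [set: 'I_p1 * 'I_p2]%SET (fun jk => B (i, jk)) (fun jk _ => mB _).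
have -> : \bigcap_(jk in [set` [set: 'I_p1 * 'I_p2]%SET])
      ((fun w => X i w jk.1 jk.2) @^-1` B (i, jk)) = (fun w => X i w) @^-1` C i.
  apply/seteqP; split=> w h jk _; last exact: (h jk Logic.I).
  by apply: h; rewrite /= inE.
move=> ->; apply: eq_big => [jk|jk _]; first by rewrite inE.
exact: law.
Qed.

Lemma entry_mgf (s : 'I_n -> 'I_p1 * 'I_p2 -> R) :
  (\int[P]_w (expR (\sum_i \sum_jk s i jk * entry i jk w))%:E =
    (expR ((\sum_i \sum_jk s i jk ^+ 2) / 2))%:E)%E.
Proof.
have := @joint_mgf R d T P _ (fun k => entry k.1 k.2) _ entries_indep
  (fun k => s k.1 k.2).
rewrite -(pair_bigA _ (fun i jk => s i jk ^+ 2)) /= => <-.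
  apply: eq_integral => w _.
  by rewrite (pair_bigA _ (fun i jk => s i jk * entry i jk w)).
by move=> k; exact: measurable_entry_RV.
Qed.

(** For the adjoint map: the equations are indexed by matrix positions and the unknown lives in the
    space of dimension [n]. *)
Lemma entry_mgf_swap (s : 'I_p1 * 'I_p2 -> 'I_n -> R) :
  (\int[P]_w (expR (\sum_jk \sum_i s jk i * entry i jk w))%:E =
    (expR ((\sum_jk \sum_i s jk i ^+ 2) / 2))%:E)%E.
Proof.
rewrite exchange_big/= -entry_mgf; apply: eq_integral => w _.
by rewrite exchange_big.
Qed.

End gaussian_entries.

(** * Deterministic analysis of the interpolant *)

Section deterministic.
Context (R : realType).

Lemma contractionN (m n : nat) (W : 'M[R]_(m, n)) : contraction W ->
  contraction (- W).
Proof. by move=> hW v; rewrite mulNmx mxdotNl mxdotNr opprK. Qed.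

Lemma nuclear_normD (m n : nat) (A B : 'M[R]_(m, n)) :
  nuclear_norm (A + B) <= nuclear_norm A + nuclear_norm B.
Proof.
have [W hW <-] := nuclear_dual (A + B).
by rewrite mxdotDr lerD// contraction_le_nuclear.
Qed.

Lemma nuclear_normN (m n : nat) (A : 'M[R]_(m, n)) :
  nuclear_norm (- A) <= nuclear_norm A.
Proof.
have [W hW <-] := nuclear_dual (- A).
by rewrite mxdotNr -mxdotNl contraction_le_nuclear//; exact: contractionN.
Qed.

(** Divided by the nuclear norm, [h] is a convex combination of products u v^T of vectors in unit
    balls. Expanding u and v separately in their lattice hulls multiplies the weights. *)
Lemma nuclear_hull (p1 p2 : nat) (h : 'M[R]_(p1, p2)) : nuclear_norm h != 0 ->
  exists (L : finType) (al : L -> R) (f : L -> lattice 'I_p1 * lattice 'I_p2),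
  [/\ forall l, 0 <= al l, \sum_l al l = 1 &
      forall j k, h j k = nuclear_norm h *
        \sum_l al l * (lattice_vec R (f l).1 j * lattice_vec R (f l).2 k)].
Proof.
have [s [u [v [suv hE nE]]]] := nuclear_decomposition h => n0.
have hull m (y : 'I_p2 * bool -> 'cV[R]_m) :
  (forall k, mxdot (y k) (y k) <= 1) ->
    exists (al : 'I_p2 * bool -> {ffun 'I_m -> bool} -> R)
      (g : 'I_p2 * bool -> {ffun 'I_m -> bool} -> lattice 'I_m),
    forall k, [/\ forall b, 0 <= al k b, \sum_b al k b = 1 &
      forall j, \sum_b al k b * lattice_vec R (g k b) j = y k j 0].
  move=> y1.
  have /choice[ag agP] : forall k, exists ag : ({ffun 'I_m -> bool} -> R) *
      ({ffun 'I_m -> bool} -> lattice 'I_m),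
      [/\ forall b, 0 <= ag.1 b, \sum_b ag.1 b = 1 &
      forall j, \sum_b ag.1 b * lattice_vec R (ag.2 b) j = y k j 0].
    move=> k; have [|al [g agP]] := @lattice_hull R 'I_m (fun j => y k j 0).
      apply: le_trans (y1 k); rewrite mxdotE; apply: ler_sum => j _.
      by rewrite big_ord1 expr2.
    by exists (al, g).
  by exists (fun k => (ag k).1), (fun k => (ag k).2).
have [al [f alP]] := hull _ u (fun k => let: And3 _ h _ := suv k in h).
have [be [g beP]] := hull _ v (fun k => let: And3 _ _ h := suv k in h).
exists (('I_p2 * bool) * ({ffun 'I_p1 -> bool} * {ffun 'I_p2 -> bool}))%type.
exists (fun l => s l.1 / nuclear_norm h * (al l.1 l.2.1 * be l.1 l.2.2)).
exists (fun l => (f l.1 l.2.1, g l.1 l.2.2)); split.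
- move=> l; have [s0 _ _] := suv l.1; have [a0 _ _] := alP l.1;
    have [b0 _ _] := beP l.1.
  by rewrite !mulr_ge0// invr_ge0 nuclear_norm_ge0.
- rewrite -(pair_bigA _ (fun k ab =>
    s k / nuclear_norm h * (al k ab.1 * be k ab.2)))/=.
  transitivity (\sum_k s k / nuclear_norm h);
    last by rewrite -mulr_suml -nE divff.
  apply: eq_bigr => k _; rewrite -mulr_sumr.
  rewrite -(pair_bigA _ (fun a b => al k a * be k b))/= -big_distrlr /=.
  by have [_ -> _] := alP k; have [_ -> _] := beP k; rewrite !mulr1.
- move=> j k; rewrite {1}hE summxE.
  rewrite -(pair_bigA _ (fun i ab =>
    s i / nuclear_norm h * (al i ab.1 * be i ab.2) *
    (lattice_vec R (f i ab.1) j * lattice_vec R (g i ab.2) k)))/= mulr_sumr.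
  apply: eq_bigr => i _; rewrite !mxE big_ord1 mxE.
  have [_ _ <-] := alP i; have [_ _ <-] := beP i.
  rewrite big_distrlr/= pair_bigA !mulr_sumr; apply: eq_bigr => ab _ /=.
  by field.
Qed.

Lemma robust_interpolation (n p1 p2 s : nat) (K : R)
    (X : 'I_n -> 'M[R]_(p1, p2))    (hstar hhat : 'M[R]_(p1, p2)) (xi Y :
      'rV[R]_n) :
  (0 < n)%N -> (0 < p1)%N -> (0 < p2)%N -> 0 < K -> (\rank hstar <= s)%N ->
  (forall la : 'rV[R]_n, (p1 * p2)%:R / 12 * \sum_i la 0 i ^+ 2 <=
     mxdot (\sum_i la 0 i *: X i) (\sum_i la 0 i *: X i)) ->
  (forall h : 'M[R]_(p1, p2), n%:R / 6 * mxdot h h <=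
     \sum_i mxdot (X i) h ^+ 2 + K * (p1 + p2)%:R * nuclear_norm h ^+ 2) ->
  (forall i, Y 0 i = mxdot (X i) hstar + xi 0 i) ->
  min_nuclear_norm_interpolant X Y hhat ->
  frobenius_norm (hhat - hstar) ^+ 2 <= (12 + 576 * K) *
    (frobenius_norm xi ^+ 2 / n%:R +
     nuclear_norm hstar ^+ 2 * ((p1 + p2)%:R / n%:R)) /\
  ((s * maxn p1 p2)%:R <= (432 * K)^-1 * n%:R ->
   frobenius_norm (hhat - hstar) ^+ 2 <=
     (12 + 576 * K) * (frobenius_norm xi ^+ 2 / n%:R)).
Proof.
move=> n0 p10 p20 K0 rs hlow hrip YE [hint hmin].
set q : R := (p1 + p2)%:R; set N : R := n%:R.
have N0 : 0 < N by rewrite ltr0n.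
have pp0 : 0 < (p1 * p2)%:R :> R by rewrite ltr0n muln_gt0 p10.
have [|g gX gxi] := least_norm_interpolant _ hlow xi; first by rewrite divr_gt0.
set Z := frobenius_norm xi ^+ 2;
  have ZE : mxdot xi xi = Z by rewrite /Z frobenius_norm_sq.
have Z0 : 0 <= Z by exact: sqr_ge0.
pose G := nuclear_norm g; have G0 : 0 <= G by exact: nuclear_norm_ge0.
(* From the factor 12 in |g|^2 <= 12 Z / (p1 p2) and the inequality (p1 + p2) min(p1, p2) <= 2 p1
   p2. *)
have qG : q * G ^+ 2 <= 24 * Z.
  have G2 : G ^+ 2 <= (minn p1 p2)%:R * mxdot g g.
    rewrite -frobenius_norm_sq -[X in X * _](@sqr_sqrtr R)// -exprMn lerXn2r
      ?nnegrE//.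
      by rewrite mulr_ge0 ?sqrtr_ge0.
    exact: nuclear_le_frobenius.
  have qm : q * (minn p1 p2)%:R <= 2 * (p1 * p2)%:R.
    rewrite /q -!natrM ler_nat; rewrite mulnDl mul2n -addnn.
    case: (leqP p1 p2) => [hp|/ltnW hp]; apply: leq_add => //.
    - by rewrite leq_mul2l hp orbT.
    - by rewrite mulnC.
    - by rewrite leq_mul2r hp orbT.
  have q0 : 0 <= q by [].
  have gg0 := mxdot_ge0 g; rewrite ZE in gxi.
  apply: (le_trans (ler_wpM2l q0 G2)); rewrite mulrA.
  apply: (le_trans (ler_wpM2r gg0 qm)); lra.
pose D := hhat - hstar.
have DX : \sum_i mxdot (X i) D ^+ 2 = Z.
  rewrite -ZE mxdotE big_ord1; apply: eq_bigr => i _.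
  by rewrite /D mxdotDr mxdotNr hint YE addrAC subrr add0r expr2.
have hhatle : nuclear_norm hhat <= nuclear_norm hstar + G.
  apply: le_trans (nuclear_normD _ _); apply: hmin => i.
  by rewrite mxdotDr gX YE.
set H := nuclear_norm hstar; have H0 : 0 <= H by exact: nuclear_norm_ge0.
set F := frobenius_norm D ^+ 2;
  have FE : mxdot D D = F by rewrite /F frobenius_norm_sq.
have F0 : 0 <= F by exact: sqr_ge0.
have q0 : 0 <= q by [].
have := hrip D; rewrite DX FE -/N -/q => hD.
have D0 : 0 <= nuclear_norm D by exact: nuclear_norm_ge0.
split.
  have D1 : nuclear_norm D <= 2 * H + G.
    rewrite (le_trans (nuclear_normD _ _))//.
    have := nuclear_normN hstar; rewrite -/H -/G in hhatle *; lra.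
  have D2 : nuclear_norm D ^+ 2 <= 8 * H ^+ 2 + 2 * G ^+ 2.
    have : nuclear_norm D ^+ 2 <= (2 * H + G) ^+ 2.
      by rewrite lerXn2r ?nnegrE// (le_trans D0).
    have := sqr_ge0 (2 * H - G); lra.
  rewrite (mulrA _ q) -mulrDl mulrA ler_pdivlMr//.
  have h1 : q * nuclear_norm D ^+ 2 <= q * (8 * H ^+ 2) + 2 * (24 * Z).
    apply: (le_trans (ler_wpM2l q0 D2)); lra.
  have h2 := ler_wpM2l (ltW K0) h1.
  have h3 : 0 <= H ^+ 2 * q by rewrite mulr_ge0// sqr_ge0.
  have h4 : 0 <= K * Z by rewrite mulr_ge0// ltW.
  have h5 : 0 <= K * (H ^+ 2 * q) by rewrite mulr_ge0// ltW.
  rewrite -/F; lra.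
move=> hs; pose r : R := Num.sqrt (\rank hstar)%:R.
have D1 : nuclear_norm D <= 3 * (r * frobenius_norm D) + G.
  by apply: nuclear_cone; rewrite /D addrC subrK.
have r2 : r ^+ 2 <= s%:R by rewrite sqr_sqrtr// ler_nat.
have D2 : nuclear_norm D ^+ 2 <= 18 * (s%:R * F) + 2 * G ^+ 2.
  have : nuclear_norm D ^+ 2 <= (3 * (r * frobenius_norm D) + G) ^+ 2.
    by rewrite lerXn2r ?nnegrE// (le_trans D0).
  have : (r * frobenius_norm D) ^+ 2 <= s%:R * F.
    by rewrite exprMn ler_wpM2r.
  have := sqr_ge0 (3 * (r * frobenius_norm D) - G); lra.
(* The constant [432 * K] makes the term [18 * K * (q * s%:R * F)] at most [N * F / 12]. It absorbs
   half of [N / 6 * F], and what remains gives exactly [12 + 576 * K]. *)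
have qs : q * s%:R <= 2 * ((432 * K)^-1 * N).
  apply: le_trans (ler_wpM2l _ hs) => //.
  rewrite /q -!natrM ler_nat mulnC mulnCA leq_mul2l; apply/orP; right.
  by rewrite mul2n -addnn leq_add// ?leq_maxl ?leq_maxr.
have Kqs : K * (q * s%:R) <= N / 216.
  apply: (le_trans (ler_wpM2l (ltW K0) qs)).
  by rewrite le_eqVlt; apply/orP; left; apply/eqP; field; rewrite gt_eqF.
have h1 : q * nuclear_norm D ^+ 2 <= 18 * (q * s%:R * F) + 2 * (24 * Z).
  apply: (le_trans (ler_wpM2l q0 D2)); lra.
have h2 := ler_wpM2l (ltW K0) h1.
have h3 := ler_wpM2r F0 Kqs.
have h4 : 0 <= K * Z by rewrite mulr_ge0// ltW.
rewrite mulrA ler_pdivlMr// -/F; lra.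
Qed.

End deterministic.

(** * High-probability events *)

Section numerics.
Context (R : realType).

Lemma natr64X_le (m : nat) : (64 ^ m)%:R <= expR (6 * m%:R) :> R.
Proof.
rewrite mulrC expRM_natl natrX lerXn2r ?nnegrE ?expR_ge0//.
have -> : expR 6 = expR 1 ^+ 6 :> R by rewrite -expRM_natl mulr1.
have e1 : 2 <= expR 1 :> R by have := expR_ge1Dx (1 : R); lra.
have -> : 64 = 2 ^+ 6 :> R by rewrite -natrX.
by rewrite lerXn2r ?nnegrE ?expR_ge0.
Qed.

Lemma ln_nat_ge_half (m : nat) : (2 <= m)%N -> 1 / 2 <= ln m%:R :> R.
Proof.
move=> m2; have m0 : 0 < m%:R :> R by rewrite ltr0n (leq_trans _ m2).
rewrite -ler_expR lnK ?posrE//; apply: (@le_trans _ _ 2);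
  last by rewrite (ler_nat _ 2).
have := expR_ge1Dx (- (1 / 2) : R); have := expR_gt0 (1 / 2 : R).
have := expRD (1 / 2 : R) (- (1 / 2)); rewrite subrr expR0; nra.
Qed.

End numerics.

Section events.
Context (R : realType) (d : measure_display) (T : measurableType d)
  (P : probability T R) (n p1 p2 : nat)
  (X : 'I_n -> {RV P >-> borel_mx R p1 p2}).
Hypotheses (n0 : (0 < n)%N) (p10 : (0 < p1)%N) (p20 : (0 < p2)%N).
Hypothesis X_indep : mutually_independent P (fun (i : 'I_n) (w : T) => X i w).
Hypothesis X_gauss : forall i : 'I_n, standard_gaussian_mx P (X i).

Lemma adjoint_lower_bound_event :
  10 ^+ 7 * n%:R <= (p1 * p2)%:R :> R ->
  exists2 E : set T, measurable E &
    ((1 - expR (- (9 * n%:R)))%:E <= P E)%E /\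
    forall w, E w -> forall la : 'rV[R]_n,
      (p1 * p2)%:R / 12 * \sum_i la 0 i ^+ 2 <=
        mxdot (\sum_i la 0 i *: (X i w : 'M[R]_(p1, p2)))
          (\sum_i la 0 i *: (X i w : 'M[R]_(p1, p2))).
Proof.
set N : R := (p1 * p2)%:R => hN.
have cN : #|{: 'I_p1 * 'I_p2}| = (p1 * p2)%N by rewrite card_prod !card_ord.
(* With this [r] the Maurey error 1600 N / (r - 1) equals N / 12, half of the main term N / 6 for a
   unit vector. The factor [10 ^+ 7] in the hypothesis pays for the union over [r]-tuples. *)
have [r rE] : exists r : nat, r%:R = 192 * 10 ^+ 2 + 1 :> R.
  by exists (192 * 10 ^ 2).+1; rewrite -natr1 natrM natrX.
have [||E mE [PE hE]] :=
  @restricted_lower_bound R d T P ('I_p1 * 'I_p2)%type 'I_n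
  (fun jk i => entry X i jk) (fun jk i => measurable_entry_RV X i jk)
  (entry_mgf_swap X_indep X_gauss) (lattice 'I_n) (@lattice_vec R 'I_n) r.
- by rewrite -(ltr0n R) rE; lra.
- by move=> k; apply: le_trans (lattice_vec_norm R k) _; lra.
exists E => //; split.
  apply: le_trans PE; rewrite cN lee_fin lerD2l lerN2 -/N.
  have n1 : 1 <= n%:R :> R by rewrite ler1n.
  have hK : (#|{: lattice 'I_n}|)%:R <= expR (6 * n%:R) :> R.
    apply: le_trans (natr64X_le R n); rewrite ler_nat.
    by have := card_lattice R 'I_n; rewrite card_ord.
  have t1 : (#|{: lattice 'I_n}| ^ r)%:R * expR (- (N / 24)) <=
    expR (- (10 * n%:R)) :> R.
    apply: (@le_trans _ _ (expR (6 * n%:R) ^+ r * expR (- (N / 24)))).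
      by rewrite ler_wpM2r ?expR_ge0// natrX lerXn2r ?nnegrE ?expR_ge0.
    rewrite -expRM_natl -expRD ler_expR rE; lra.
  have t2 : (#|{: lattice 'I_n}| * 64 ^ (p1 * p2))%:R * expR (- (8 * N)) <=
    expR (- (10 * n%:R)) :> R.
    apply: (@le_trans _ _ (expR (6 * n%:R) * expR (6 * N) * expR (- (8 * N)))).
      by rewrite ler_wpM2r ?expR_ge0// natrM ler_pM// natr64X_le.
    rewrite -!expRD ler_expR; lra.
  have t3 : 2 * expR (- (10 * n%:R)) <= expR (- (9 * n%:R)) :> R.
    have -> : - (9 * n%:R) = n%:R + - (10 * n%:R) :> R by ring.
    rewrite expRD ler_wpM2r ?expR_ge0//.
    by have := expR_ge1Dx (n%:R : R); lra.
  by apply: (le_trans (lerD t1 t2)); apply: le_trans t3;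
    rewrite [2 * _]mulr_natl mulr2n.
move=> w Ew la.
set S := \sum_i _.
have S0 : 0 <= S by apply: sumr_ge0 => i _; exact: sqr_ge0.
have [->|Sn0] := eqVneq S 0; first by rewrite mulr0 mxdot_ge0.
have sS0 : Num.sqrt S != 0 by rewrite sqrtr_eq0 -ltNge lt_neqAle eq_sym Sn0.
have [|al [f [al0 al1 fE]]] :=
  @lattice_hull R 'I_n (fun i => la 0 i / Num.sqrt S).
  under eq_bigr do rewrite exprMn.
  by rewrite -mulr_suml exprVn sqr_sqrtr// divff.
have := hE w Ew _ al f (fun i => (Num.sqrt S)^-1 * la 0 i) al0 al1.
rewrite cN -/N => /(_ _)/wrap[]; first by move=> i; rewrite fE mulrC.
under eq_bigr do rewrite exprMn.
under [X in _ <= _ * X + _]eq_bigr do rewrite designZ exprMn.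
rewrite -!mulr_sumr -/S exprVn sqr_sqrtr// mulVf// mulr1.
have -> : \sum_jk design (fun jk i => entry X i jk) (fun i =>
  la 0 i) w jk ^+ 2 =
  mxdot (\sum_i la 0 i *: (X i w : 'M[R]_(p1, p2))) (\sum_i la 0 i *: (X i w :
    'M[R]_(p1, p2))).
  rewrite mxdotE pair_bigA/=; apply: eq_bigr => -[j k] _ /=.
  rewrite -expr2 summxE; congr (_ ^+ 2); apply: eq_bigr => i _.
  by rewrite mxE.
set V := mxdot _ _; rewrite rE => h.
have {}Sn0 : 0 < S by rewrite lt_neqAle eq_sym Sn0.
have : N / 12 <= S^-1 * V by lra.
by rewrite [S^-1 * V]mulrC ler_pdivlMr.
Qed.

Lemma nuclear_restricted_event :
  480 * (p1 + p2)%:R <= n%:R :> R ->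
  exists2 E : set T, measurable E &
    ((1 - 2 * expR (- (n%:R / 60)))%:E <= P E)%E /\
    forall w, E w -> forall h : 'M[R]_(p1, p2),
      n%:R / 6 * mxdot h h <=
        \sum_i mxdot (X i w : 'M[R]_(p1, p2)) h ^+ 2 +
          (1536 * 10 ^+ 3) * (p1 + p2)%:R * nuclear_norm h ^+ 2.
Proof.
set q := (p1 + p2)%N; move=> hn; set N : R := n%:R.
(* The union over [r]-tuples costs the exponent 6 q r <= N / 40, and 1/24 - 1/40 = 1/60 is left. The
   hypothesis ensures [2 <= r], so that [r - 1] is positive. *)
pose r := (n %/ (240 * q))%N.
have q0 : (0 < q)%N by rewrite addn_gt0 p10.
have q1 : 1 <= q%:R :> R by rewrite ler1n.
have r2 : (2 <= r)%N.
  by rewrite leq_divRL ?muln_gt0// mulnA -(ler_nat R) natrM.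
have rle : r%:R * (240 * q%:R) <= N.
  by rewrite -!natrM ler_nat leq_divM.
have rge : N <= (r%:R + 1) * (240 * q%:R).
  by rewrite -!natrM natr1 -natrM ler_nat ltnW// ltn_ceil// muln_gt0.
have [||E mE [PE hE]] :=
  @restricted_lower_bound R d T P 'I_n ('I_p1 * 'I_p2)%type
  (entry X) (measurable_entry_RV X) (entry_mgf X_indep X_gauss)
  (lattice 'I_p1 * lattice 'I_p2)%type
  (fun ab jk => lattice_vec R ab.1 jk.1 * lattice_vec R ab.2 jk.2) r.
- exact: leq_trans r2.
- move=> [a b]; rewrite -(pair_bigA _ (fun j k =>
    (lattice_vec R a j * lattice_vec R b k) ^+ 2))/=.
  have := lattice_vec_norm R a; have := lattice_vec_norm R b.
  under [X in _ -> _ -> is_true (X <= _)]eq_bigr => j _.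
    under eq_bigr do rewrite exprMn.
    rewrite -mulr_sumr.
    over.
  rewrite -mulr_suml.
  set x := \sum_i _; set y := \sum_i _.
  have : 0 <= x by apply: sumr_ge0 => i _; exact: sqr_ge0.
  have : 0 <= y by apply: sumr_ge0 => i _; exact: sqr_ge0.
  nra.
exists E => //; split.
  apply: le_trans PE; rewrite card_ord lee_fin lerD2l lerN2 -/N.
  set K := #|_|.
  have hK : K%:R <= expR (6 * q%:R) :> R.
    apply: le_trans (natr64X_le R q); rewrite ler_nat /K card_prod /q expnD.
    have := card_lattice R 'I_p1; have := card_lattice R 'I_p2;
      rewrite !card_ord => k1 k2.
    exact: leq_mul.
  have t1 : (K ^ r)%:R * expR (- (N / 24)) <= expR (- (N / 60)) :> R.
    apply: (@le_trans _ _ (expR (6 * q%:R) ^+ r * expR (- (N / 24)))).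
      by rewrite ler_wpM2r ?expR_ge0// natrX lerXn2r ?nnegrE ?expR_ge0.
    rewrite -expRM_natl -expRD ler_expR; lra.
  have t2 : (K * 64 ^ n)%:R * expR (- (8 * N)) <= expR (- (N / 60)) :> R.
    apply: (@le_trans _ _ (expR (6 * q%:R) * expR (6 * N) * expR (- (8 * N)))).
      by rewrite ler_wpM2r ?expR_ge0// natrM ler_pM// natr64X_le.
    rewrite -!expRD ler_expR; lra.
  by apply: (le_trans (lerD t1 t2)); rewrite [2 * _]mulr_natl mulr2n.
move=> w Ew h; set S := nuclear_norm h.
have S0 : 0 <= S by exact: nuclear_norm_ge0.
have [S00|Sn0] := eqVneq S 0.
  have hh0 : mxdot h h = 0.
    have := frobenius_le_nuclear h; rewrite -/S S00 => h0.
    rewrite -frobenius_norm_sq; have -> : frobenius_norm h = 0.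
      by apply/eqP; rewrite eq_le h0 frobenius_norm_ge0.
    by rewrite expr0n.
  by rewrite hh0 S00 mulr0 expr0n mulr0 addr0 sumr_ge0// => i _; exact: sqr_ge0.
have [L [al [f [al0 al1 fE]]]] := nuclear_hull Sn0.
have := hE w Ew _ al f (fun jk => S^-1 * h jk.1 jk.2) al0 al1.
rewrite card_ord -/N => /(_ _)/wrap[]; first by move=> [j k] /=;
  rewrite fE mulKf.
under eq_bigr do rewrite exprMn.
under [X in _ <= _ * X + _]eq_bigr do rewrite designZ exprMn.
rewrite -!mulr_sumr.
have -> : \sum_i design (entry X) (fun jk => h jk.1 jk.2) w i ^+ 2 =
    \sum_i mxdot (X i w : 'M[R]_(p1, p2)) h ^+ 2.
  apply: eq_bigr => i _; congr (_ ^+ 2); rewrite mxdotE pair_bigA /=.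
  by apply: eq_bigr => -[j k] _; rewrite mulrC.
have -> : \sum_(jk : 'I_p1 * 'I_p2) h jk.1 jk.2 ^+ 2 = mxdot h h.
  by rewrite mxdotE pair_bigA/=; apply: eq_bigr => -[j k] _; rewrite expr2.
set V := \sum_i _; set F := mxdot h h => hh.
have r1 : 0 < r%:R - 1 :> R by rewrite subr_gt0 ltr1n.
have {}Sn0 : 0 < S by rewrite lt_neqAle eq_sym Sn0.
have S2 : 0 < S ^+ 2 by rewrite exprn_gt0.
have key : (r%:R - 1) * (N / 6 * F) <= (r%:R - 1) * V + 1600 * N * S ^+ 2.
  have uS : S^-1 ^+ 2 * S ^+ 2 = 1 by rewrite -exprMn mulVf ?expr1n// gt_eqF.
  have u0 : 0 < S^-1 ^+ 2 by rewrite exprn_gt0// invr_gt0.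
  move: hh uS u0; set u := S^-1 ^+ 2 => hh uS u0.
  rewrite -(ler_pM2l u0).
  have -> : u * ((r%:R - 1) * V + 1600 * N * S ^+ 2) =
    (r%:R - 1) * (u * V) + 1600 * N * (u * S ^+ 2) by ring.
  have -> : u * ((r%:R - 1) * (N / 6 * F)) = (r%:R - 1) * (N / 6 * (u * F))
    by ring.
  by rewrite uS mulr1.
(* As [2 <= r], r + 1 <= 3 (r - 1), so the rounding in [r] is harmless. The final constant is 1600 *
   960 = 1536 * 10^3. *)
have rq : N <= (r%:R - 1) * (960 * q%:R).
  have r2' : 2 <= r%:R :> R by rewrite (ler_nat _ 2).
  nra.
rewrite -(ler_pM2l r1) mulrDr (le_trans key)// lerD2l.
have := ler_wpM2r (ltW S2) rq; lra.
Qed.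

End events.

(** * Absolute constants and intersection of the two events *)

Theorem theorem3p5 (R : realType) :
  exists C c1 c2 c3 : R, [/\ 0 < C, 0 < c1, 0 < c2, 0 < c3 &
  forall (n p1 p2 s : nat) (d : measure_display) (T : measurableType d)
    (P : probability T R)
    (X : 'I_n -> {RV P >-> borel_mx R p1 p2})
    (hstar : 'M[R]_(p1, p2)) (xi : T -> 'rV[R]_n),
  let Y (w : T) : 'rV[R]_n := \row_i (mxdot (X i w) hstar + xi w ord0 i) in
  let is_estimator (w : T) (hhat : 'M[R]_(p1, p2)) : Prop :=
    min_nuclear_norm_interpolant (fun i => X i w) (Y w) hhat in
  (0 < n)%N -> (0 < p1)%N -> (0 < p2)%N ->
  mutually_independent P (fun (i : 'I_n) (w : T) => X i w) ->
  (forall i : 'I_n, standard_gaussian_mx P (X i)) ->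
  (\rank hstar <= s)%N ->
  n%:R * ln ((n * (p1 + p2))%:R) <= c1 * (p1 * p2)%:R ->
  exists E : set T,
    [/\ measurable E,
        ((1 - expR (- (c2 * n%:R)))%:E <= P E)%E,
        (forall (w : T) (hhat : 'M[R]_(p1, p2)), E w -> is_estimator w hhat ->
           frobenius_norm (hhat - hstar) ^+ 2 <=
             C * (frobenius_norm (xi w) ^+ 2 / n%:R +
                  nuclear_norm hstar ^+ 2 * ((p1 + p2)%:R / n%:R))) &
        ((s * maxn p1 p2)%:R <= c3 * n%:R ->
         forall (w : T) (hhat : 'M[R]_(p1, p2)), E w -> is_estimator w hhat ->
           frobenius_norm (hhat - hstar) ^+ 2 <=
             C * (frobenius_norm (xi w) ^+ 2 / n%:R))]].
Proof.
pose K : R := 1536 * 10 ^+ 3;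
  have K0 : 0 < K by rewrite mulr_gt0 ?exprn_gt0 ?ltr0n.
exists (12 + 576 * K), (2 * 10 ^+ 7)^-1, (1 / 120), (432 * K)^-1; split.
- by rewrite addr_gt0 ?mulr_gt0 ?ltr0n.
- by rewrite invr_gt0 mulr_gt0 ?exprn_gt0 ?ltr0n.
- by rewrite divr_gt0 ?ltr0n.
- by rewrite invr_gt0 mulr_gt0 ?ltr0n.
move=> n p1 p2 s d T P X hstar xi Y is_estimator n0 p10 p20 Xind Xgauss rs hln.
have n1 : 1 <= n%:R :> R by rewrite ler1n.
(* The logarithm is at least 1/2 because its argument is at least 2; the factor 2 in the constant
   [c1] compensates for this half. *)
have hN : 10 ^+ 7 * n%:R <= (p1 * p2)%:R :> R.
  have m2 : (2 <= n * (p1 + p2))%N.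
    by rewrite -[2%N]/(1 * (1 + 1))%N leq_mul// leq_add.
  have c10 : 0 < 2 * 10 ^+ 7 :> R by rewrite mulr_gt0 ?exprn_gt0 ?ltr0n.
  move: hln; rewrite [leRHS]mulrC ler_pdivlMr// => hln; apply: le_trans hln.
  have := ler_wpM2l (ler0n R n) (ln_nat_ge_half R m2).
  by move: (ln _) => l; lra.
(* The properties required of [E] involve only the design, so the bounds hold for every value of
   [xi w], however it depends on the design. *)
suff [E mE [PE hE]] : exists2 E : set T, measurable E &
    ((1 - expR (- (1 / 120 * n%:R)))%:E <= P E)%E /\ forall w, E w ->
    (forall la : 'rV[R]_n, (p1 * p2)%:R / 12 * \sum_i la 0 i ^+ 2 <=
       mxdot (\sum_i la 0 i *: (X i w : 'M[R]_(p1, p2)))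
         (\sum_i la 0 i *: (X i w : 'M[R]_(p1, p2)))) /\
    (forall h : 'M[R]_(p1, p2), n%:R / 6 * mxdot h h <=
       \sum_i mxdot (X i w : 'M[R]_(p1, p2)) h ^+ 2 +
         K * (p1 + p2)%:R * nuclear_norm h ^+ 2).
  have main w hhat : E w -> is_estimator w hhat -> _ := fun Ew est =>
    robust_interpolation n0 p10 p20 K0 rs (hE w Ew).1 (hE w Ew).2
      (fun i => (mxE _ _ _ _ : Y w 0 i = _)) est.
  exists E; split => //.
    by move=> w hhat Ew est; exact: (main w hhat Ew est).1.
  by move=> hs w hhat Ew est; exact: (main w hhat Ew est).2 hs.
have [E1 mE1 [PE1 hE1]] := adjoint_lower_bound_event n0 Xind Xgauss hN.
(* If [n] is below [480 * (p1 + p2)], the second property holds for every outcome: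
   [K * (p1 + p2)%:R] exceeds [n%:R / 6] and the Frobenius norm is at most the nuclear norm. Then
   [E1] alone suffices. *)
have [hn|hn] := leP (480 * (p1 + p2)%:R) (n%:R : R).
  have [E2 mE2 [PE2 hE2]] := nuclear_restricted_event p10 Xind Xgauss hn.
  exists (E1 `&` E2); first exact: measurableI.
  split; last by move=> w [w1 w2]; split; [exact: hE1|exact: hE2].
  apply: le_trans (probability_setI_ge mE1 mE2 PE1 PE2).
  rewrite lee_fin lerD2l lerN2.
  set N : R := n%:R in hn n1 *.
  (* The failure probabilities add up to at most [3 * expR (- (N / 60))]. Halving the rate to 1/120
     absorbs the factor 3, since [3 <= 1 + N / 120]. *)
  have N960 : 960 <= N.
    have : 2 <= (p1 + p2)%:R :> R by rewrite (ler_nat _ 2) (leq_add p10 p20).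
    lra.
  apply: (@le_trans _ _ (3 * expR (- (N / 60)))).
    have -> : 3 * expR (- (N / 60)) = expR (- (N / 60)) + 2 * expR (- (N / 60))
      by ring.
    by rewrite lerD2r ler_expR; lra.
  have -> : - (1 / 120 * N) = N / 120 + - (N / 60) by field.
  rewrite expRD ler_wpM2r ?expR_ge0//.
  by have := expR_ge1Dx (N / 120); lra.
exists E1 => //; split.
  apply: le_trans PE1; rewrite lee_fin lerD2l lerN2 ler_expR; lra.
move=> w Ew; split; first exact: hE1.
move=> h; apply: (@le_trans _ _ (K * (p1 + p2)%:R * nuclear_norm h ^+ 2));
  last first.
  by rewrite lerDr sumr_ge0// => i _; exact: sqr_ge0.
rewrite -frobenius_norm_sq; apply: ler_pM => //.
- exact: sqr_ge0.
- have : 0 <= (p1 + p2)%:R :> R by [].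
  rewrite /K; lra.
- by rewrite lerXn2r ?nnegrE ?frobenius_norm_ge0 ?nuclear_norm_ge0//
    frobenius_le_nuclear.
Qed.
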